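(* Let $A$ be a dilation on $\mathbb{R}^n$, $1\le p<\infty$, $\theta>0$, $q(\cdot)\in\mathcal{B}(\mathbb{R}^n)$, and let $\alpha(\cdot)\in L^\infty(\mathbb{R}^n)$ be a real-valued function which is log-H\''older continuous at the origin and at infinity, with $0<\alpha(0),\alpha_\infty<\delta_2$. If a sublinear operator $T$ satisfies, for some constant $C>0$, $$|Tf(x)|\le C\int_{\mathbb{R}^n}\frac{|f(y)|}{\rho(x-y)}\,dy,\qquad x\notin\operatorname{supp}f,$$ for any $f\in L^{q(\cdot)}(\mathbb{R}^n)$ with compact support, and $T$ is bounded on $L^{q(\cdot)}(\mathbb{R}^n)$, then $T$ is bounded on $\dot{K}^{\alpha(\cdot),p)}_{q(\cdot),\theta}(A;\mathbb{R}^n)$ and on $K^{\alpha(\cdot),p)}_{q(\cdot),\theta}(A;\mathbb{R}^n)$, respectively.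
   Context: Dilations. A dilation is a real $n\times n$ matrix $A$ all of whose eigenvalues $\lambda$ satisfy $|\lambda|>1$; $b=|\det A|$. Fix an ellipsoid $\Delta=\{x\in\mathbb{R}^n:|Px|<1\}$ ($P$ a nondegenerate $n\times n$ matrix) with $|\Delta|=1$ and a number $r>1$ such that $\Delta\subset r\Delta\subset A\Delta$. For $k\in\mathbb{Z}$ put $B_k=A^k\Delta$ (so $|B_k|=b^k$ and $B_k\subset rB_k\subset B_{k+1}$), $C_k=B_k\setminus B_{k-1}$, $\chi_k=\chi_{C_k}$; $\tilde\chi_k=\chi_{C_k}$ for $k\ge1$ and $\tilde\chi_0=\chi_{B_0}$. The step homogeneous quasi-norm is $\rho(x)=b^j$ if $x\in B_{j+1}\setminus B_j$, and $\rho(0)=0$. Variable exponents. $\mathcal{P}(\mathbb{R}^n)$ is the set of measurable $q(\cdot):\mathbb{R}^n\to[1,\infty)$ with $q^-=\operatorname{ess\,inf} q>1$ and $q^+=\operatorname{ess\,sup}q<\infty$; $q'(x)=q(x)/(q(x)-1)$. The norm is $\|f\|_{L^{q(\cdot)}(\mathbb{R}^n)}=\inf\{\lambda>0:\int_{\mathbb{R}^n}(|f(x)|/\lambda)^{q(x)}dx\le1\}$. $L^{q(\cdot)}_{\rm loc}(\Omega)$ is the set of $f$ with $f\in L^{q(\cdot)}(E)$ for all compact $E\subset\Omega$. $\mathcal{B}(\mathbb{R}^n)$ is the set of $q(\cdot)\in\mathcal{P}(\mathbb{R}^n)$ such that the Hardy-Littlewood maximal operator $Mf(x)=\sup_{B\ni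 x}|B|^{-1}\int_B|f(y)|dy$ (supremum over all balls $B$ containing $x$) is bounded on $L^{q(\cdot)}(\mathbb{R}^n)$. For $q(\cdot)\in\mathcal{B}(\mathbb{R}^n)$, $\delta_2$ with $0<\delta_2<1$ is a constant (known to exist) such that, for some constant $C$, for all balls $B$ in $\mathbb{R}^n$ and all measurable $S\subset B$, $\|\chi_S\|_{L^{q'(\cdot)}(\mathbb{R}^n)}/\|\chi_B\|_{L^{q'(\cdot)}(\mathbb{R}^n)}\le C(|S|/|B|)^{\delta_2}$. A function $g:\mathbb{R}^n\to\mathbb{R}$ is log-H\''older continuous at the origin if there is $C>0$ with $|g(x)-g(0)|\le C/\log(e+1/|x|)$ for all $x$, and log-H\''older continuous at infinity if there are $g_\infty\in\mathbb{R}$ and $C>0$ with $|g(x)-g_\infty|\le C/\log(e+|x|)$ for all $x$. $\alpha_\infty$ denotes this limit for $\alpha(\cdot)$. Spaces. $\dot{K}^{\alpha(\cdot),p)}_{q(\cdot),\theta}(A;\mathbb{R}^n)$ is the set of $f\in L^{q(\cdot)}_{\rm loc}(\mathbb{R}^n\setminus\{0\})$ with finite norm $$\|f\|_{\dot{K}^{\alpha(\cdot),p)}_{q(\cdot),\theta}(A;\mathbb{R}^n)}=\sup_{\varepsilon>0}\Big(\varepsilon^\theta\sum_{k=-\infty}^\infty\|b^{k\alpha(\cdot)}f\chi_k\|_{L^{q(\cdot)}(\mathbb{R}^n)}^{p(1+\varepsilon)}\Big)^{\frac1{p(1+\varepsilon)}},$$ and $K^{\alpha(\cdot),p)}_{q(\cdot),\theta}(A;\mathbb{R}^n)$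 is the set of $f\in L^{q(\cdot)}_{\rm loc}(\mathbb{R}^n)$ with finite norm $$\|f\|_{K^{\alpha(\cdot),p)}_{q(\cdot),\theta}(A;\mathbb{R}^n)}=\sup_{\varepsilon>0}\Big(\varepsilon^\theta\sum_{k=0}^\infty\|b^{k\alpha(\cdot)}f\tilde\chi_k\|_{L^{q(\cdot)}(\mathbb{R}^n)}^{p(1+\varepsilon)}\Big)^{\frac1{p(1+\varepsilon)}}.$$
   Formalization: Balls in the maximal operator and in the condition on δ_2 are translates of the B_k, not Euclidean balls; the sublinear T, on a linear domain of measurable functions, must also satisfy |Tf| ≤ Σ_j|T(fχ_{E_j})| a.e. for countable measurable partitions. The claim fails without these. *)

(* Defs.v *)
From HB Require Import structures.
From mathcomp Require Import all_boot all_order all_algebra.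
From mathcomp Require Import complex.
From mathcomp Require Import all_classical all_reals all_analysis.
From mathcomp Require Import ess_sup_inf.

Set Implicit Arguments.
Unset Strict Implicit.
Unset Printing Implicit Defensive.

Import Order.TTheory GRing.Theory Num.Theory.
Import numFieldNormedType.Exports.

Local Open Scope classical_set_scope.
Local Open Scope ring_scope.

(** Lebesgue measure on R^n: the product sigma-algebra and the n-fold product
of the one-dimensional Lebesgue measure are built on [n.-tuple R], transported
to the column vectors ['cV[R]_n] (which carry the topology and the action of
matrices), and completed, so that "measurable" below means Lebesgue
measurable. *)

Section tuple_lebesgue.
Context {R : realType}.
Local Notation rT := (measurableTypeR R).

Definition cons_pair (n : nat) (p : rT * n.-tuple rT) : n.+1.-tuple rT :=
  [the n.+1.-tuple rT of p.1 :: p.2].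

Lemma measurable_cons_pair (n : nat) :
  measurable_fun [set: rT * n.-tuple rT] (@cons_pair n).
Proof. exact: measurable_cons. Qed.

Section successor.
Variables (n : nat) (m : {sigma_finite_measure set (n.-tuple rT) -> \bar R}).

Definition tuple_lebesgueS : set (n.+1.-tuple rT) -> \bar R :=
  pushforward (lebesgue_measure \x m)%E (@cons_pair n).

Let pm0 : tuple_lebesgueS set0 = 0%E.
Proof. by rewrite /tuple_lebesgueS /pushforward preimage_set0 measure0. Qed.

Let pm_ge0 A : (0 <= tuple_lebesgueS A)%E.
Proof. exact: (measure_ge0 (lebesgue_measure \x m)%E). Qed.

Let pm_sigma : semi_sigma_additive tuple_lebesgueS.
Proof.
have mc := @measurable_cons_pair n.
move=> F mF tF mUF.
rewrite /tuple_lebesgueS /pushforward preimage_bigcup.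
apply: measure_semi_sigma_additive.
- by move=> k; rewrite -[X in measurable X]setTI; exact: mc.
- apply/trivIsetP => /= i j _ _ ij; rewrite -preimage_setI.
  by move/trivIsetP : tF => /(_ _ _ _ _ ij) ->//; rewrite preimage_set0.
- by rewrite -preimage_bigcup -[X in measurable X]setTI; exact: mc.
Qed.

HB.instance Definition _ := isMeasure.Build _ _ _ tuple_lebesgueS
  pm0 pm_ge0 pm_sigma.

Let pm_sigma_finite : sigma_finite setT tuple_lebesgueS.
Proof.
have /sigma_finiteP[F [TF ndF Foo]] := sigma_finiteT (@lebesgue_measure R).
have /sigma_finiteP[G [TG ndG Goo]] := sigma_finiteT m.
pose u (t : n.+1.-tuple rT) : rT * n.-tuple rT :=
  (tnth t ord0, [tuple of behead t]).
have mu_ : measurable_fun setT u.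
  apply/measurable_fun_pairP; split; first exact: measurable_tnth.
  exact: measurable_behead.
have uK p : u (cons_pair p) = p.
  by case: p => a t; congr pair; apply/val_inj.
exists (fun k => u @^-1` (F k `*` G k)).
  rewrite -preimage_bigcup -[LHS](preimage_setT u); congr (_ @^-1` _).
  rewrite -setXTT TF TG predeqE => -[x y]; split.
    move=> [/= [i _ Fix] [k _ Gky]]; exists (maxn i k) => //; split.
    - by move: x Fix; exact/subsetPset/ndF/leq_maxl.
    - by move: y Gky; exact/subsetPset/ndG/leq_maxr.
  by move=> [i _ []/= ? ?]; split; exists i.
move=> k; have [mF Fk] := Foo k; have [mG Gk] := Goo k.
split.
  by rewrite -[X in measurable X]setTI; apply: mu_ => //; exact: measurableX.
rewrite /tuple_lebesgueS /pushforward -comp_preimage.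
rewrite (_ : u \o _ = id) ?preimage_id; last first.
  by apply/funext => p /=; exact: uK.
by rewrite product_measure1E// lte_mul_pinfty// ge0_fin_numE.
Qed.

HB.instance Definition _ := Measure_isSigmaFinite.Build _ _ _ tuple_lebesgueS
  pm_sigma_finite.

End successor.

Fixpoint tuple_lebesgue (n : nat) :
    {sigma_finite_measure set (n.-tuple rT) -> \bar R} :=
  match n with
  | 0 => [the {sigma_finite_measure set (0.-tuple rT) -> \bar R}
          of @dirac _ (0.-tuple rT) [tuple] R]
  | n.+1 => [the {sigma_finite_measure set (n.+1.-tuple rT) -> \bar R}
          of tuple_lebesgueS (tuple_lebesgue n)]
  end.

End tuple_lebesgue.

Definition cvec_display : measure_display. Proof. exact: default_measure_display. Qed.

Section cvec_measurable.
Context {R : realType} {n : nat}.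

Let coords (i : 'I_n) (v : 'cV[R]_n) : measurableTypeR R := v i ord0.

Let cvec_set0 : g_sigma_preimage coords set0.
Proof. exact: sigma_algebra0. Qed.

Let cvec_setC A : g_sigma_preimage coords A -> g_sigma_preimage coords (~` A).
Proof. exact: sigma_algebraC. Qed.

Let cvec_bigcup (F : (set 'cV[R]_n)^nat) :
  (forall i, g_sigma_preimage coords (F i)) ->
  g_sigma_preimage coords (\bigcup_i (F i)).
Proof. exact: sigma_algebra_bigcup. Qed.

HB.instance Definition _ := @isMeasurable.Build cvec_display
  'cV[R]_n (g_sigma_preimage coords) cvec_set0 cvec_setC cvec_bigcup.

Definition cvec_of_tuple (t : n.-tuple (measurableTypeR R)) : 'cV[R]_n :=
  \col_i tnth t i.

Lemma measurable_cvec_of_tuple : measurable_fun setT cvec_of_tuple.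
Proof.
move=> _ A mA; rewrite setTI.
have -> : measurable = g_sigma_preimage (fun i => coords i \o cvec_of_tuple).
  congr g_sigma_preimage; apply/funext => i; apply/funext => t /=.
  by rewrite /coords mxE.
by rewrite g_sigma_preimage_comp; exists A; rewrite ?setTI.
Qed.

Definition borel_lebesgue : set 'cV[R]_n -> \bar R :=
  pushforward (tuple_lebesgue n) cvec_of_tuple.

Let bl0 : borel_lebesgue set0 = 0%E.
Proof. by rewrite /borel_lebesgue /pushforward preimage_set0 measure0. Qed.

Let bl_ge0 A : (0 <= borel_lebesgue A)%E.
Proof. exact: (measure_ge0 (tuple_lebesgue n)). Qed.

Let bl_sigma : semi_sigma_additive borel_lebesgue.
Proof.
have mc := measurable_cvec_of_tuple.
move=> F mF tF mUF.
rewrite /borel_lebesgue /pushforward preimage_bigcup.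
apply: measure_semi_sigma_additive.
- by move=> k; rewrite -[X in measurable X]setTI; exact: mc.
- apply/trivIsetP => /= i j _ _ ij; rewrite -preimage_setI.
  by move/trivIsetP : tF => /(_ _ _ _ _ ij) ->//; rewrite preimage_set0.
- by rewrite -preimage_bigcup -[X in measurable X]setTI; exact: mc.
Qed.

HB.instance Definition _ := isMeasure.Build _ _ _ borel_lebesgue
  bl0 bl_ge0 bl_sigma.

End cvec_measurable.

(** R^n with the sigma-algebra of Lebesgue measurable sets. *)
Definition Rn (R : realType) (n : nat) :=
  caratheodory_type ((@borel_lebesgue R n)^*)%mu.

Definition leb (R : realType) (n : nat) : {measure set (Rn R n) -> \bar R} :=
  [the {measure set (Rn R n) -> \bar R} of
   @completed_measure_extension cvec_display 'cV[R]_n R (@borel_lebesgue R n)].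

Section notions.
Context {R : realType} {n : nat}.
Local Notation V := 'cV[R]_n.
Local Notation mu := (leb R n).

Definition lmeasurable (E : set V) : Prop := measurable (E : set (Rn R n)).

Definition lmeasurable_fun (f : V -> R) : Prop :=
  measurable_fun (setT : set (Rn R n)) (f : Rn R n -> R).

Definition enorm (x : V) : R := Num.sqrt (\sum_i x i ord0 ^+ 2).

Definition restr (f : V -> R) (E : set V) : V -> R := fun x => f x * \1_E x.

Definition supp (f : V -> R) : set V := closure [set x | f x != 0].

(** Variable exponent Lebesgue spaces *)

Definition exponent (q : V -> R) : Prop :=
  [/\ lmeasurable_fun q, forall x, 1 <= q x,
      (1 < ess_inf mu (EFin \o q : Rn R n -> \bar R))%E &
      (ess_sup mu (EFin \o q : Rn R n -> \bar R) < +oo)%E].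

Definition conj_exponent (q : V -> R) : V -> R := fun x => q x / (q x - 1).

(* Extended-real-valued arguments are needed for the maximal function; the
   norm is [+oo] when no admissible [l] exists. *)
Definition enormLq (q : V -> R) (f : V -> \bar R) : \bar R :=
  ereal_inf [set l%:E | l in [set l : R |
    0 < l /\ (\int[mu]_x ((`|f x| * (l^-1)%:E) `^ q x) <= 1)%E]].

Definition normLq (q f : V -> R) : \bar R := enormLq q (EFin \o f).

Definition Lq (q : V -> R) : set (V -> R) :=
  [set f | lmeasurable_fun f /\ (normLq q f < +oo)%E].

Definition Lq_loc (q : V -> R) (Omega : set V) : set (V -> R) :=
  [set f | forall E : set V, compact E -> E `<=` Omega -> Lq q (restr f E)].

Definition bounded_on (X : set (V -> R)) (N : (V -> R) -> \bar R)
    (T : (V -> R) -> (V -> R)) : Prop :=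
  exists2 C : R, 0 < C &
    forall f, X f -> X (T f) /\ (N (T f) <= C%:E * N f)%E.

Definition Linfty (g : V -> R) : Prop :=
  lmeasurable_fun g /\
  (ess_sup mu ((fun x => `|g x|%:E) : Rn R n -> \bar R) < +oo)%E.

(* At [x = 0] the library convention [0^-1 = 0] is harmless: the left-hand
   side vanishes there. *)
Definition log_holder_origin (g : V -> R) : Prop :=
  exists2 C : R, 0 < C &
    forall x, `|g x - g 0| <= C / ln (expR 1 + (enorm x)^-1).

Definition log_holder_infty (g : V -> R) (ginf : R) : Prop :=
  exists2 C : R, 0 < C &
    forall x, `|g x - ginf| <= C / ln (expR 1 + enorm x).

(** [T] is a sublinear operator with domain the linear space [D] of measurable
functions. Subadditivity is also required for the countable decompositions
[f = \sum_j f 1_(E_j)] attached to a measurable partition of R^n; when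
[D = L^q] and [T] is bounded on [L^q] this follows from finite subadditivity,
but it is what determines [T] up to domination on functions outside [L^q]. *)
Record sublinear_operator (D : set (V -> R)) (T : (V -> R) -> (V -> R)) :
    Prop := SublinearOperator {
  dom_measurable : forall f, D f -> lmeasurable_fun f ;
  dom_add : forall f g, D f -> D g -> D (f \+ g) ;
  dom_scale : forall (c : R) f, D f -> D (fun x => c * f x) ;
  op_measurable : forall f, D f -> lmeasurable_fun (T f) ;
  op_subadditive : forall f g, D f -> D g ->
    {ae mu, forall x, `|T (f \+ g) x| <= `|T f x| + `|T g x|} ;
  op_homogeneous : forall (c : R) f, D f ->
    {ae mu, forall x, `|T (fun y => c * f y) x| = `|c| * `|T f x|} ;
  op_countably_subadditive : forall f (E : (set V)^nat),
    D f -> (forall j, lmeasurable (E j)) ->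
    trivIset setT E -> \bigcup_j E j = setT ->
    (forall j, D (restr f (E j))) ->
    {ae mu, forall x,
      (`|T f x|%:E <= \sum_(0 <= j <oo) `|T (restr f (E j)) x|%:E)%E}
}.

End notions.

Section dilation.
Context {R : realType} {n : nat}.
Local Notation V := 'cV[R]_n.+1.
Local Notation mu := (leb R n.+1).

Definition is_dilation (A : 'M[R]_n.+1) : Prop :=
  forall l : R[i], eigenvalue (map_mx (real_complex R) A) l -> 1 < `|l|.

Definition is_ellipsoid (Delta : set V) : Prop :=
  exists2 P : 'M[R]_n.+1, P \in unitmx &
    Delta = [set x | enorm (P *m x) < 1].

Definition dilate (r : R) (S : set V) : set V := [set r *: x | x in S].

Definition mximage (A : 'M[R]_n.+1) (S : set V) : set V := [set A *m x | x in S].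

Variables (A : 'M[R]_n.+1) (Delta : set V).

Definition absdet : R := `|\det A|.

Local Notation b := absdet.

Definition Bk (k : int) : set V := mximage (A ^ k) Delta.

Definition Ck (k : int) : set V := Bk k `\` Bk (k - 1).

Definition Ctk (k : nat) : set V := if k is 0 then Bk 0 else Ck k%:Z.

Definition rho (x : V) : R :=
  if x == 0 then 0 else b ^ (xget 0 [set j : int | (Bk (j + 1) `\` Bk j) x]).

(** The balls of the homogeneous quasi-norm [rho]: since
[Bk k = [set y | rho y < b ^ k]], they are exactly the translates
[z + Bk k]. They play the role of the Euclidean balls in the definition of
the maximal operator and of the exponent [delta2]; for [A] isotropic the two
families give equivalent notions. *)
Definition rho_ball (z : V) (s : R) : set V := [set y | rho (y - z) < s].

Definition balls : set (set V) :=
  [set S | exists z s, 0 < s /\ S = rho_ball z s].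

Definition maximal (f : V -> R) (x : V) : \bar R :=
  ereal_sup [set ((fine (mu B))^-1%:E * \int[mu]_(y in (B : set (Rn R n.+1))) `|f y|%:E)%E
            | B in [set B | balls B /\ B x]].

Definition Bclass (q : V -> R) : Prop :=
  exponent q /\
  exists2 C : R, 0 < C &
    forall f, Lq q f -> (enormLq q (maximal f) <= C%:E * normLq q f)%E.

Definition delta2_condition (q : V -> R) (delta2 : R) : Prop :=
  exists2 C : R, 0 < C &
    forall B S, balls B -> lmeasurable S -> S `<=` B ->
      fine (normLq (conj_exponent q) \1_S) / fine (normLq (conj_exponent q) \1_B)
      <= C * (fine (mu S) / fine (mu B)) `^ delta2.

(** Grand Herz spaces with variable exponents *)

Variables (alpha q : V -> R) (p theta : R).

(* [b ^ (k alpha(.)) f 1_E] *)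
Definition weighted (k : int) (f : V -> R) (E : set V) : V -> R :=
  fun x => b `^ (k%:~R * alpha x) * restr f E x.

Definition herz_norm (f : V -> R) : \bar R :=
  ereal_sup [set
    (((eps `^ theta)%:E *
      \esum_(k in [set: int])
        (normLq q (weighted k f (Ck k))) `^ (p * (1 + eps)))
     `^ (p * (1 + eps))^-1)%E
  | eps in [set eps : R | 0 < eps]].

Definition herz : set (V -> R) :=
  [set f | Lq_loc q (~` [set 0]) f /\ (herz_norm f < +oo)%E].

Definition nonhom_herz_norm (f : V -> R) : \bar R :=
  ereal_sup [set
    (((eps `^ theta)%:E *
      \sum_(0 <= k <oo)
        (normLq q (weighted k%:Z f (Ctk k))) `^ (p * (1 + eps)))
     `^ (p * (1 + eps))^-1)%E
  | eps in [set eps : R | 0 < eps]].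

Definition nonhom_herz : set (V -> R) :=
  [set f | Lq_loc q setT f /\ (nonhom_herz_norm f < +oo)%E].

Definition size_condition (T : (V -> R) -> (V -> R)) : Prop :=
  exists2 C : R, 0 < C &
    forall f, Lq q f -> compact (supp f) ->
      {ae mu, forall x, ~ supp f x ->
        (`|T f x|%:E <= C%:E * \int[mu]_y (`|f y| / rho (x - y))%:E)%E}.

End dilation.

(* Main.v *)
Require Import Defs.
From mathcomp Require Import all_boot all_order all_algebra.
From mathcomp Require Import all_classical all_reals all_analysis.
From mathcomp Require Import measurable_realfun ess_sup_inf.
From mathcomp Require Import complex zify ring lra.

Set Implicit Arguments.
Unset Strict Implicit.
Unset Printing Implicit Defensive.

Import Order.TTheory GRing.Theory Num.Theory.
Import numFieldNormedType.Exports.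

Local Open Scope classical_set_scope.
Local Open Scope ring_scope.

(* On a shell [C_k] the weight [b^(k alpha)] is comparable to the constant
   [b^(k alpha(0))] or [b^(k alphainf)] by log-Hoelder continuity, so everything
   reduces to bounding [T (f 1_(C_j))] on [C_k] in [L^q]. For [j >= k - w]
   boundedness of [T] on [L^q] suffices. For [j < k - w] the quasi-distance between
   the two shells is at least [b^(k - w)], so the size condition, Hoelder's
   inequality, [||1_B||_q ||1_B||_q' <= C |B|] (from the maximal function) and the
   definition of [delta2] give the factor [b^((j - k) delta2)]. As
   [0 < alpha(0), alphainf < delta2], the resulting kernel in [(k, j)] decays
   geometrically in [|k - j|], and Schur's test bounds it on [l^P] uniformly in
   [P = p (1 + eps)]. *)

(** * Lebesgue measure on R^n under affine maps *)

Lemma measurable_cvecP (R : realType) d (T : measurableType d) n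
    (f : T -> 'cV[R]_n) :
  (forall i, measurable_fun setT (fun t => f t i ord0 : measurableTypeR R)) ->
  measurable_fun setT f.
Proof.
move=> mf.
have : g_sigma_preimage (fun i => (fun v : 'cV[R]_n => v i ord0 : measurableTypeR R) \o f)
    `<=` measurable.
  apply: smallest_sub; first exact: sigma_algebra_measurable.
  case: n => [|n] in f mf *; first by rewrite big_ord0.
  rewrite -bigcup_mkord_ord; apply: bigcup_sub => i Ii.
  by move=> A [B mB <-]; exact: mf.
rewrite g_sigma_preimage_comp => prefS _ A mA.
by apply: prefS; exists A.
Qed.

Lemma measurable_coord (R : realType) n (i : 'I_n) :
  measurable_fun setT (fun v : 'cV[R]_n => v i ord0 : measurableTypeR R).
Proof.
move=> _ Y mY; rewrite setTI; apply: sub_sigma_algebra => /=.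
rewrite -bigcup_seq/=; exists i => /=; first by rewrite mem_index_enum.
by exists Y => //; rewrite setTI.
Qed.

Lemma measurable_affine (R : realType) m n (M : 'M[R]_(m, n)) (c : 'cV[R]_m) :
  measurable_fun setT (fun v : 'cV[R]_n => M *m v + c : 'cV[R]_m).
Proof.
apply: measurable_cvecP => i.
rewrite (_ : (fun _ => _) =
  (fun v : 'cV[R]_n => \sum_j M i j * v j ord0 + c i ord0 : measurableTypeR R)); last first.
  by apply/funext => v; rewrite !mxE.
apply: measurable_funD; last exact: measurable_cst.
apply: measurable_sum => j.
by apply: measurable_funM => //; exact: measurable_coord.
Qed.

Lemma lebesgue_measure_affine (R : realType) (a c : R) (S : set R) :
  a != 0 -> measurable (S : set (measurableTypeR R)) ->
  (`|a|%:E * lebesgue_measure ((fun x => a * x + c)%R @^-1` S) = lebesgue_measure S)%E.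
Proof.
move=> a0 mS; apply/esym.
pose f (x : measurableTypeR R) : measurableTypeR R := a * x + c.
have mf : measurable_fun setT f.
  by apply: measurable_funD => //; apply: measurable_funM.
have Na0 : (0 <= `|a|) by [].
pose mu := mscale (NngNum Na0) (pushforward (@lebesgue_measure R) f).
transitivity (mu mf S) => //.
apply: (@lebesgue_measure_unique R [the {measure set (measurableTypeR R) -> \bar R} of mu mf]) => // _ [[x y]] _ <-.
change (lebesgue_measure `]x, y] = `|a|%:E * lebesgue_measure (f @^-1` `]x, y]))%E.
have [xy|yx] := ltP x y; last first.
  by rewrite set_itv_ge ?preimage_set0 ?measure0 ?mule0// bnd_simp -leNgt.
have [ap|an|/eqP] := ltgtP 0 a; last by rewrite eq_sym (negPf a0).
  rewrite (_ : f @^-1` _ = `](x - c) / a, (y - c) / a]%classic); last first.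
    apply/seteqP; split => z /=; rewrite !in_itv/= /f ltr_pdivrMr// ler_pdivlMr//;
    by rewrite ltrBlDr lerBrDr mulrC.
  rewrite !lebesgue_measure_itv/= !lte_fin xy ltr_pM2r ?invr_gt0// ltrD2r xy.
  rewrite -!EFinD -EFinM gtr0_norm// -mulrBl; congr EFin.
  by field.
rewrite (_ : f @^-1` _ = `[(y - c) / a, (x - c) / a[%classic); last first.
  apply/seteqP; split => z /=; rewrite !in_itv/= /f ltr_ndivlMr// ler_ndivrMr//;
  by rewrite ltrBlDr lerBrDr mulrC andbC.
rewrite !lebesgue_measure_itv/= !lte_fin xy ltr_nM2r ?invr_lt0// ltrD2r xy.
rewrite -!EFinD -EFinM ltr0_norm// -mulrBl; congr EFin.
by field.
Qed.

Lemma cvec_of_tuple_cons (R : realType) n (x : measurableTypeR R)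
    (t : n.-tuple (measurableTypeR R)) :
  cvec_of_tuple (cons_pair (x, t)) = col_mx (x : R)%:M (cvec_of_tuple t) :> 'cV[R]_(1 + n).
Proof.
apply/matrixP => i j; rewrite ord1 /cvec_of_tuple/= !mxE.
case: splitP => k ik.
  have -> : i = ord0 by apply/val_inj => /=; rewrite ik ord1.
  by rewrite !mxE/= ord1.
have -> : i = lift ord0 k by apply/val_inj; rewrite /= ik.
by rewrite tnthS mxE.
Qed.

Lemma measurable_col_mx (R : realType) n :
  measurable_fun setT
    (fun p : measurableTypeR R * 'cV[R]_n => col_mx (p.1 : R)%:M p.2 : 'cV[R]_(1 + n)).
Proof.
apply: measurable_cvecP => i.
rewrite (_ : (fun _ => _) = fun p : measurableTypeR R * 'cV[R]_n =>
   match fintype.split i with inl _ => p.1 | inr k => p.2 k ord0 end); last first.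
  apply/funext => p; rewrite !mxE; case: fintype.split => k //.
  by rewrite mxE ord1/=.
case: fintype.split => k; first exact: measurable_fst.
exact: (measurableT_comp (measurable_coord k) measurable_snd).
Qed.

Lemma borel_lebesgueSx (R : realType) n (S : set 'cV[R]_(1 + n)) :
  measurable S ->
  borel_lebesgue S = (\int[lebesgue_measure]_x
    borel_lebesgue [set v | S (col_mx (x : R)%:M v)])%E.
Proof.
move=> mS; rewrite /borel_lebesgue/= /tuple_lebesgueS /pushforward/=.
rewrite /product_measure1; apply: eq_integral => x _ /=; congr (_ _).
by apply/seteqP; split => t; rewrite /xsection/= inE/= cvec_of_tuple_cons.
Qed.

Lemma measurable_cons_pair_preimage (R : realType) n (S : set 'cV[R]_(1 + n)) :
  measurable S ->
  measurable [set p : measurableTypeR R * n.-tuple (measurableTypeR R) |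
     S (cvec_of_tuple (cons_pair p))].
Proof.
move=> mS; have := measurableT_comp (@measurable_cvec_of_tuple R n.+1)
  (@measurable_cons_pair R n).
by move=> /(_ measurableT _ mS); rewrite setTI.
Qed.

Lemma borel_lebesgueSv (R : realType) n (S : set 'cV[R]_(1 + n)) :
  measurable S ->
  borel_lebesgue S = (\int[tuple_lebesgue n]_t
    lebesgue_measure [set x : measurableTypeR R | S (col_mx (x : R)%:M (cvec_of_tuple t))])%E.
Proof.
move=> mS.
transitivity ((lebesgue_measure \x (tuple_lebesgue n))
  [set p : measurableTypeR R * n.-tuple (measurableTypeR R) |
     S (cvec_of_tuple (cons_pair p))])%E; first by [].
rewrite (@product_measure_unique _ _ _ _ _ _ _
   [the {measure set _ -> \bar _} of lebesgue_measure \x^ tuple_lebesgue n]%E); last 2 first.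
- by move=> X Y mX mY; rewrite [LHS]product_measure2E.
- exact: measurable_cons_pair_preimage.
rewrite /= /product_measure2; apply: eq_integral => t _ /=; congr (_ _).
by apply/seteqP; split => x; rewrite /ysection/= inE/= cvec_of_tuple_cons.
Qed.

Lemma measurable_slice (R : realType) n (S : set 'cV[R]_(1 + n)) (x : R) :
  measurable S -> measurable [set v | S (col_mx x%:M v)].
Proof.
move=> mS; have := measurableT_comp (@measurable_col_mx R n)
  (pair1_measurable (x : measurableTypeR R)).
by move=> /(_ measurableT _ mS); rewrite setTI.
Qed.

Lemma measurable_slice_v (R : realType) n (S : set 'cV[R]_(1 + n)) (v : 'cV[R]_n) :
  measurable S ->
  measurable ([set x | S (col_mx x%:M v)] : set (measurableTypeR R)).
Proof.
move=> mS; have := measurableT_comp (@measurable_col_mx R n) (pair2_measurable v).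
by move=> /(_ measurableT _ mS); rewrite setTI.
Qed.

Lemma measurable_preimage_affine (R : realType) m n (M : 'M[R]_(m, n))
    (c : 'cV[R]_m) (S : set 'cV[R]_m) :
  measurable S -> measurable [set w | S (M *m w + c)].
Proof.
by move=> mS; have := @measurable_affine R m n M c measurableT _ mS; rewrite setTI.
Qed.

Lemma borel_lebesgue_upper (R : realType) n (a c : R) (u : 'rV[R]_n)
    (S : set 'cV[R]_(1 + n)) : a != 0 -> measurable S ->
  (`|a|%:E * borel_lebesgue
    [set w : 'cV[R]_(1 + n) | S (block_mx a%:M u 0 1%:M *m w + col_mx c%:M 0)%R]
  = borel_lebesgue S)%E.
Proof.
move=> a0 mS.
have mS' := @measurable_preimage_affine R _ _ (block_mx a%:M u 0 1%:M) (col_mx c%:M 0) S mS.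
rewrite (borel_lebesgueSv mS') (borel_lebesgueSv mS) -ge0_integralZl//; last first.
  have := measurable_fun_ysection (@lebesgue_measure R) (measurable_cons_pair_preimage mS').
  by apply: eq_measurable_fun => t _ /=; congr (_ _);
    apply/seteqP; split => x; rewrite /ysection/= inE/= cvec_of_tuple_cons.
apply: eq_integral => t _; set v := cvec_of_tuple t.
rewrite -[RHS](@lebesgue_measure_affine R a ((u *m v) ord0 ord0 + c)%R)//; last first.
  exact: measurable_slice_v.
congr (_ * lebesgue_measure _)%E; apply: eq_set => x /=; congr (S _).
rewrite mul_block_col mul0mx mul1mx add0r add_col_mx addr0; congr col_mx.
apply/matrixP => i j; rewrite !ord1 !mxE big_ord1 !mxE/= !mulr1n.
by rewrite addrA.
Qed.

Lemma borel_lebesgue_lower (R : realType) n (l c : 'cV[R]_n) (B : 'M[R]_n)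
    (S : set 'cV[R]_(1 + n)) :
  (forall (c : 'cV[R]_n) (S : set 'cV[R]_n), measurable S ->
    (`|\det B|%:E * borel_lebesgue [set v | S (B *m v + c)%R] = borel_lebesgue S)%E) ->
  measurable S ->
  (`|\det B|%:E * borel_lebesgue
    [set w : 'cV[R]_(1 + n) | S (block_mx 1%:M 0 l B *m w + col_mx 0 c)%R]
  = borel_lebesgue S)%E.
Proof.
move=> BE mS.
have mS' := @measurable_preimage_affine R _ _ (block_mx 1%:M 0 l B) (col_mx 0 c) S mS.
rewrite (borel_lebesgueSx mS') (borel_lebesgueSx mS) -ge0_integralZl//; last first.
  have := measurable_fun_xsection (@tuple_lebesgue R n) (measurable_cons_pair_preimage mS').
  by apply: eq_measurable_fun => x _ /=; congr (_ _);
    apply/seteqP; split => t; rewrite /xsection/= inE/= cvec_of_tuple_cons.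
apply: eq_integral => x _.
rewrite -[RHS](BE (l *m (x : R)%:M + c)); last exact: measurable_slice.
congr (_ * borel_lebesgue _)%E; apply: eq_set => v /=; congr (S _).
by rewrite mul_block_col mul0mx mul1mx addr0 add_col_mx addr0 [l *m _ + _]addrC addrA.
Qed.

(* Once a row operation has made the pivot [M 0 0] nonzero, [M] is the product of
   a lower and an upper block triangular matrix; each factor acts on slices in one
   of the two coordinates, and Fubini applies. *)
Lemma borel_lebesgue_affine (R : realType) n (M : 'M[R]_n) (c : 'cV[R]_n)
    (S : set 'cV[R]_n) : M \in unitmx -> measurable S ->
  (`|\det M|%:E * borel_lebesgue [set w | S (M *m w + c)%R] = borel_lebesgue S)%E.
Proof.
elim: n M c S => [|n IH] M c S uM mS.
  rewrite det_mx00 normr1 mul1e; congr borel_lebesgue.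
  by apply: eq_set => w; rewrite (flatmx0 w) (flatmx0 (_ + _)).
rewrite -[n.+1]/(1 + n)%N in M c S uM mS *.
wlog M0 : M c S uM mS / M ord0 ord0 != 0.
  move=> H; have [M0|] := eqVneq (M ord0 ord0) 0; last exact: H.
  have [i Mi] : exists i : 'I_n, dlsubmx M i ord0 != 0.
    apply/not_existsP => Mi0.
    have M00 : M = block_mx 0 (ursubmx M) 0 (drsubmx M).
      rewrite -[LHS]submxK; congr block_mx; apply/matrixP => i j.
        rewrite !ord1 !mxE -[RHS]M0; congr (M _ _); exact/val_inj.
      rewrite !ord1 [RHS]mxE; apply/eqP; apply: contrapT => /negP.
      exact: Mi0.
    by move: uM; rewrite M00 unitmxE det_ublock det_mx11 mxE mul0r unitr0.
  pose s : 'rV[R]_n := delta_mx 0 i.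
  pose U : 'M[R]_(1 + n) := block_mx 1%:M s 0 1%:M.
  pose V : 'M[R]_(1 + n) := block_mx 1%:M (- s) 0 1%:M.
  have VU : V *m U = 1%:M.
    rewrite mulmx_block !mul0mx !mul1mx !mulmx1 !mulmx0 !addr0 add0r addrN.
    by rewrite -scalar_mx_block.
  have dU : \det U = 1 by rewrite det_ublock !det1 mulr1.
  have UM0 : (U *m M) ord0 ord0 != 0.
    have b00 X Y Z W :
        (block_mx X Y Z W : 'M[R]_(1 + n)) (lshift n ord0) (lshift n ord0) = X ord0 ord0.
      exact: block_mxEul.
    have -> : (U *m M) ord0 ord0 = (U *m M) (lshift n ord0) (lshift n ord0).
      by congr ((_ *m _) _ _); exact/val_inj.
    rewrite -[M]submxK mulmx_block b00.
    rewrite mul1mx mxE -rowE [X in _ + X]mxE.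
    rewrite [X in X + _](_ : _ = 0) ?add0r//.
    by rewrite !mxE -[RHS]M0; congr (M _ _); exact/val_inj.
  have uUM : U *m M \in unitmx by rewrite unitmx_mul uM unitmxE dU unitr1.
  pose S' := [set z | S (V *m z + 0)].
  have mS' : measurable S' by exact: measurable_preimage_affine.
  have := H (U *m M) (U *m c) S' uUM mS' UM0.
  rewrite det_mulmx dU mul1r => H'.
  have -> : [set w | S (M *m w + c)] = [set w | S' (U *m M *m w + U *m c)].
    apply: eq_set => w; rewrite /S' /= addr0 -mulmxA -mulmxDr mulmxA VU mul1mx.
    by [].
  rewrite H'.
  have := @borel_lebesgue_upper R n 1 0 (- s) S (oner_neq0 _) mS.
  by rewrite normr1 mul1e raddf0 col_mx0.
set a := M ord0 ord0 in M0.
pose u := ursubmx M; pose l := dlsubmx M; pose B := drsubmx M.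
have ME : M = block_mx a%:M u l B.
  rewrite -[LHS]submxK; congr block_mx; apply/matrixP => i j.
  by rewrite !ord1 !mxE; congr (M _ _); exact/val_inj.
pose l' := a^-1 *: l; pose B' := B - l' *m u.
pose c0 := c ord0 ord0.
have cE : c = col_mx c0%:M (dsubmx c).
  rewrite -[LHS]vsubmxK; congr col_mx; apply/matrixP => i j.
  by rewrite !ord1 !mxE; congr (c _ _); exact/val_inj.
pose c' := dsubmx c - c0 *: l'.
have MLU : M = block_mx 1%:M 0 l' B' *m block_mx a%:M u 0 1%:M.
  rewrite mulmx_block !mul0mx !mul1mx !mulmx1 !mulmx0 !addr0 ME; congr block_mx.
    by rewrite mul_mx_scalar scalerA mulfV// scale1r.
  by rewrite /B' addrC subrK.
have dM : \det M = a * \det B'.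
  by rewrite MLU det_mulmx det_lblock det_ublock !det1 det_scalar1 mulr1 mul1r mulrC.
have uB' : B' \in unitmx.
  by move: uM; rewrite !unitmxE dM unitrM => /andP[].
rewrite dM normrM EFinM.
rewrite -(@borel_lebesgue_lower R n l' c' B' S _ mS); last by move=> *; exact: IH.
rewrite -[X in _ = (_ * X)%E](@borel_lebesgue_upper R n a c0 u)//; last exact: measurable_preimage_affine.
rewrite muleCA muleA; congr (_ * borel_lebesgue _)%E.
apply: eq_set => w /=; congr (S _).
rewrite mulmxDr mulmxA -MLU -addrA; congr (_ + _).
rewrite mul_block_col mul0mx mul1mx mulmx0 !addr0 add_col_mx addr0 cE.
congr col_mx.
by rewrite mul_mx_scalar addrC subrK.
Qed.

Lemma measurable_ball_cV (R : realType) n (c : 'cV[R]_n) (e : R) :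
  0 < e -> measurable [set w : 'cV[R]_n | ball c e w].
Proof.
move=> e0.
rewrite (_ : [set w | _] = \big[setI/setT]_(i < n)
  ((fun v : 'cV[R]_n => v i ord0 : measurableTypeR R) @^-1` ball (c i ord0) e)).
  apply: bigsetI_measurable => i _.
  by rewrite -[X in measurable X]setTI; apply: measurable_coord => //; exact: measurable_ball.
apply/seteqP; split => w /=.
  by move=> [_ H]; rewrite -bigcap_seq => i _ /=; exact: H.
rewrite -bigcap_seq => H; split => // i j; rewrite (ord1 j).
by apply: H; rewrite /= mem_index_enum.
Qed.

Lemma open_measurable_cV (R : realType) n (S : set 'cV[R]_n) :
  open S -> measurable S.
Proof.
move=> oS.
pose B (p : 'cV[rat]_n * nat) : set 'cV[R]_n :=
  [set w | ball (map_mx (@ratr R) p.1) p.2.+1%:R^-1 w].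
rewrite (_ : S = \bigcup_p (if `[< B p `<=` S >] then B p else set0)); last first.
  apply/seteqP; split => x; last by case=> p _; case: ifPn => // /asboolP; exact.
  move=> Sx; have /nbhs_ballP[e /= e0 eS] : nbhs x S by exact: open_nbhs_nbhs.
  have [k _ /(_ k (leqnn k)) /= ke] := near_infty_natSinv_lt (PosNum (divr_gt0 e0 (ltr0Sn R 1))).
  pose d : R := k.+1%:R^-1.
  have d0 : 0 < d by rewrite invr_gt0.
  have /choice[f fP] : forall i : 'I_n, exists r : rat, `|ratr r - x i ord0| < d.
    move=> i; have /rat_in_itvoo[r] : x i ord0 - d < x i ord0 + d by rewrite ltrD2l gtrN.
    by rewrite in_itv/= => /andP[? ?]; exists r; rewrite ltr_distl; apply/andP; split; lra.
  exists (\col_i f i, k) => //.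
  have -> : `[< B (\col_i f i, k) `<=` S >] = true.
    apply/asboolT => w [/= _ H]; apply: eS; split => // i j; rewrite (ord1 j).
    have := H i ord0; rewrite !mxE /ball/= => H1; have H2 := fP i.
    rewrite -(subrKA (ratr (f i))) (le_lt_trans (ler_normD _ _))//.
    by rewrite distrC (splitr e) ltrD// (lt_trans _ ke).
  split => //= i j; rewrite (ord1 j) !mxE /ball/=; exact: fP.
apply: countable_bigcupT_measurable => [|p]; first exact: countableP.
by case: ifPn => // _; apply: measurable_ball_cV; rewrite invr_gt0.
Qed.

Lemma closed_measurable_cV (R : realType) n (S : set 'cV[R]_n) :
  closed S -> measurable S.
Proof.
by move=> cS; rewrite -[S]setCK; apply: measurableC; apply: open_measurable_cV; exact: closed_openC.
Qed.

Lemma borel_lmeasurable (R : realType) n (S : set 'cV[R]_n) :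
  measurable S -> lmeasurable S.
Proof. by move=> mS; apply: sub_caratheodory; exact: sub_sigma_algebra. Qed.

Lemma lebE (R : realType) n (S : set 'cV[R]_n) :
  measurable S -> leb R n S = borel_lebesgue S.
Proof. by move=> mS; rewrite /leb/= /completed_measure_extension measurable_mu_extE. Qed.

Lemma leb_affine (R : realType) n (M : 'M[R]_n) (c : 'cV[R]_n)
    (S : set 'cV[R]_n) : M \in unitmx -> measurable S ->
  (`|\det M|%:E * leb R n [set w | S (M *m w + c)%R] = leb R n S)%E.
Proof.
move=> uM mS; rewrite !lebE//; first exact: borel_lebesgue_affine.
exact: measurable_preimage_affine.
Qed.

(** * The balls of the anisotropic quasi-norm *)

Section enorm.
Context {R : realType} {n : nat}.
Implicit Types x y : 'cV[R]_n.

Lemma enorm_ge0 x : 0 <= enorm x. Proof. exact: sqrtr_ge0. Qed.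

Lemma enorm_sqr x : enorm x ^+ 2 = \sum_i x i ord0 ^+ 2.
Proof. by rewrite sqr_sqrtr// sumr_ge0// => i _; exact: sqr_ge0. Qed.

Lemma enormZ (c : R) x : enorm (c *: x) = `|c| * enorm x.
Proof.
apply/eqP; rewrite -(@eqrXn2 _ 2)// ?mulr_ge0// ?enorm_ge0//.
rewrite exprMn !enorm_sqr real_normK ?num_real// mulr_sumr; apply/eqP.
by apply: eq_bigr => i _; rewrite mxE exprMn.
Qed.

Lemma enorm0 : enorm (0 : 'cV[R]_n) = 0.
Proof. by rewrite -(scale0r 0) enormZ normr0 mul0r. Qed.

Lemma coord_le_enorm x i : `|x i ord0| <= enorm x.
Proof.
rewrite -(@ler_pXn2r _ 2)// ?nnegrE ?enorm_ge0// enorm_sqr real_normK ?num_real//.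
by rewrite (bigD1 i)//= lerDl sumr_ge0// => j _; exact: sqr_ge0.
Qed.

Lemma enorm_le_sum x : enorm x <= \sum_i `|x i ord0|.
Proof.
have s0 (I : Type) (s : seq I) (f : I -> R) : 0 <= \sum_(i <- s) `|f i| by rewrite sumr_ge0.
rewrite -(@ler_pXn2r _ 2)// ?nnegrE ?enorm_ge0// enorm_sqr.
elim: (index_enum _) => [|i s IH]; first by rewrite !big_nil expr0n.
rewrite !big_cons sqrrD real_normK ?num_real// -addrA lerD2l.
by rewrite (le_trans IH)// lerDr mulrn_wge0// mulr_ge0// s0.
Qed.

Lemma enormD_lt2 x y : enorm x < 1 -> enorm y < 1 -> enorm (x + y) < 2.
Proof.
move=> x1 y1; rewrite -(@ltr_pXn2r _ 2)// ?nnegrE ?enorm_ge0//.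
have xx : enorm x ^+ 2 < 1 by rewrite expr_lt1// enorm_ge0.
have yy : enorm y ^+ 2 < 1 by rewrite expr_lt1// enorm_ge0.
rewrite (@le_lt_trans _ _ (2 * (enorm x ^+ 2 + enorm y ^+ 2)))//; last by lra.
rewrite !enorm_sqr -big_split/= mulr_sumr ler_sum// => i _; rewrite mxE.
have := sqr_ge0 (x i ord0 - y i ord0); rewrite !expr2; lra.
Qed.

Lemma enorm_eq0 x : enorm x = 0 -> x = 0.
Proof.
move=> x0; apply/matrixP => i j; rewrite ord1 mxE; apply/eqP.
by rewrite -normr_eq0 eq_le normr_ge0 andbT -x0 coord_le_enorm.
Qed.

Lemma normr_le_enorm x : `|x| <= enorm x.
Proof.
change (mx_norm x <= enorm x); rewrite mx_normrE; apply/bigmax_leP; split; first exact: enorm_ge0.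
by move=> [i j] _; rewrite (ord1 j); exact: coord_le_enorm.
Qed.

End enorm.

Lemma enorm_mulmx_bound (R : realType) m n (M : 'M[R]_(m, n)) :
  exists2 K : R, 0 < K & forall x : 'cV[R]_n, enorm (M *m x) <= K * enorm x.
Proof.
have S0 : 0 <= \sum_i \sum_j `|M i j| by rewrite sumr_ge0// => i _; rewrite sumr_ge0.
exists (1 + \sum_i \sum_j `|M i j|); first by rewrite ltr_pwDl.
move=> x; rewrite (le_trans (enorm_le_sum _))//.
apply: (@le_trans _ _ ((\sum_i \sum_j `|M i j|) * enorm x)); last first.
  by rewrite ler_wpM2r ?enorm_ge0// lerDr.
rewrite mulr_suml ler_sum// => i _; rewrite mxE mulr_suml.
rewrite (le_trans (ler_norm_sum _ _ _))// ler_sum// => j _.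
by rewrite normrM ler_wpM2l// coord_le_enorm.
Qed.

Lemma continuous_enorm_mulmx (R : realType) m n (M : 'M[R]_(m, n.+1)) :
  continuous (fun x : 'cV[R]_n.+1 => enorm (M *m x)).
Proof.
have cc i : continuous (fun x : 'cV[R]_n.+1 => (M *m x) i ord0).
  rewrite (_ : (fun _ => _) = fun x : 'cV[R]_n.+1 => \sum_j M i j * x j ord0); last first.
    by apply/funext => x; rewrite mxE.
  apply: (@continuous_big R _ +%R 0 xpredT _ _ _ (fun j (x : 'cV[R]_n.+1) => M i j * x j ord0)).
    exact: add_continuous.
  by move=> j _ x; apply: (cvgM (cvg_cst (M i j)) (@coord_continuous _ _ _ j ord0 x)).
move=> x; apply: (@continuous_comp _ _ _ (fun x => \sum_i (M *m x) i ord0 ^+ 2) Num.sqrt);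
  last exact: sqrt_continuous.
apply: (@continuous_big R _ +%R 0 xpredT _ _ _ (fun i (x : 'cV[R]_n.+1) => (M *m x) i ord0 ^+ 2)).
  exact: add_continuous.
by move=> i _ y; apply: (@continuous_comp _ _ _ (fun x : 'cV[R]_n.+1 => (M *m x) i ord0) (fun t => t ^+ 2)); [exact: cc|exact: exprn_continuous].
Qed.

Lemma open_enorm_lt (R : realType) m n (M : 'M[R]_(m, n.+1)) (c : R) :
  open [set x : 'cV[R]_n.+1 | enorm (M *m x) < c].
Proof.
apply: (@open_comp _ _ (fun x : 'cV[R]_n.+1 => enorm (M *m x)) [set t | t < c]).
  by move=> x _; exact: continuous_enorm_mulmx.
exact: open_lt.
Qed.

Lemma closed_enorm_le (R : realType) m n (M : 'M[R]_(m, n.+1)) (c : R) :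
  closed [set x : 'cV[R]_n.+1 | enorm (M *m x) <= c].
Proof.
apply: (@closed_comp _ _ (fun x : 'cV[R]_n.+1 => enorm (M *m x)) [set t | t <= c]).
  by move=> x _; exact: continuous_enorm_mulmx.
exact: closed_le.
Qed.

Lemma bounded_closed_compact_cV (R : realType) n (S : set 'cV[R]_n) (c : R) :
  (forall x, S x -> enorm x <= c) -> closed S -> compact S.
Proof.
move=> Sc cS.
have ct : continuous (@trmx R 1 n).
  move=> x V /nbhs_ballP[e /= e0 eV]; apply/nbhs_ballP; exists e => //= y [_ xy].
  by apply: eV; split => // i j; rewrite !mxE; exact: xy.
have box : compact [set v : 'rV[R]_n | forall i, v ord0 i \in `[(- c), c]].
  by apply: (@rV_compact _ _ (fun=> `[(- c), c]%classic)) => i; exact: segment_compact.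
have := continuous_compact (continuous_subspaceT ct) box.
move/(subclosed_compact cS); apply => x Sx; exists x^T; last exact: trmxK.
move=> i /=; rewrite in_itv/= -ler_norml mxE (le_trans _ (Sc _ Sx))//.
exact: coord_le_enorm.
Qed.

Lemma dilation_unitmx (R : realType) n (A : 'M[R]_n.+1) :
  is_dilation A -> A \in unitmx.
Proof.
move=> hA; rewrite -(map_unitmx (real_complex R)) -row_free_unit -kermx_eq0.
apply: contrapT => /negP K0.
have /hA : eigenvalue (map_mx (real_complex R) A) 0.
  by rewrite /eigenvalue /eigenspace raddf0 subr0.
by rewrite normr0 ltr10.
Qed.

Lemma expr_unbounded (R : realType) (r c : R) : 1 < r -> exists m : nat, c < r ^+ m.
Proof.
move=> r1; have r10 : 0 < r - 1 by rewrite subr_gt0.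
have H m : m%:R * (r - 1) <= r ^+ m.
  elim: m => [|m IH]; first by rewrite mul0r.
  rewrite -natr1 mulrDl mul1r (_ : r ^+ m.+1 = r ^+ m + (r - 1) * r ^+ m); last by rewrite exprS; ring.
  by rewrite lerD// ler_peMr ?exprn_ege1// ltW.
have [c0|c0] := leP c 0; first by exists 0; rewrite expr0 (le_lt_trans c0).
exists (Num.bound (c / (r - 1))); apply: lt_le_trans (H _).
by rewrite -ltr_pdivrMr// archi_boundP// divr_ge0// ltW.
Qed.

Section anisotropic_balls.
Context {R : realType} {n : nat}.
Variables (A : 'M[R]_n.+1) (Delta : set 'cV[R]_n.+1) (P : 'M[R]_n.+1) (r : R).
Hypotheses (uA : A \in unitmx) (uP : P \in unitmx)
  (DeltaE : Delta = [set x | enorm (P *m x) < 1])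
  (Delta1 : leb R n.+1 Delta = 1%E) (r1 : 1 < r)
  (rDelta : dilate r Delta `<=` mximage A Delta).
Local Notation B := (Bk A Delta).
Local Notation b := (absdet A).
Implicit Types (k l j : int) (x y : 'cV[R]_n.+1).

Lemma mulmx_exprzVK k x : A ^ k *m (A ^ (- k) *m x) = x.
Proof. by rewrite mulmxA mulmxE -exprzDr ?unitmxE// subrr expr0z mul1mx. Qed.

Lemma mulmx_exprzKV k x : A ^ (- k) *m (A ^ k *m x) = x.
Proof. by have := mulmx_exprzVK (- k) x; rewrite opprK. Qed.

Lemma BkE k x : B k x <-> enorm (P *m (A ^ (- k) *m x)) < 1.
Proof.
rewrite /Bk /mximage DeltaE; split => [[y /= Py <-]|Px]; first by rewrite mulmx_exprzKV.
by exists (A ^ (- k) *m x) => //; rewrite mulmx_exprzVK.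
Qed.

Lemma Bk_lt1 k : B k = [set x | enorm ((P *m A ^ (- k)) *m x) < 1].
Proof.
by apply/seteqP; split => x; rewrite BkE/= mulmxA.
Qed.

Lemma open_Bk k : open (B k). Proof. rewrite Bk_lt1; exact: open_enorm_lt. Qed.

Lemma measurable_Bk k : measurable (B k).
Proof. by apply: open_measurable_cV; exact: open_Bk. Qed.

Lemma measurable_Ck k : measurable (Ck A Delta k).
Proof. by apply: measurableD; exact: measurable_Bk. Qed.

Lemma absdet_gt0 : 0 < b.
Proof. by rewrite normr_gt0 -unitfE -unitmxE. Qed.

Lemma det_exprz k : \det (A ^ k) = (\det A) ^ k.
Proof.
have dX m : \det (A ^+ m) = \det A ^+ m.
  by elim: m => [|m IH]; rewrite ?det1// !exprS -mulmxE det_mulmx IH.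
by case: k => m; rewrite /exprz ?dX// [LHS]det_inv dX.
Qed.

Lemma leb_Bk k : leb R n.+1 (B k) = (b ^ k)%:E.
Proof.
have uAk : A ^ (- k) \in unitmx by rewrite unitrXz.
have m0 : measurable Delta by have := measurable_Bk 0; rewrite /Bk expr0z /mximage; congr (measurable _);
  apply/seteqP; split => [x [y Dy <-]|x Dx]; rewrite ?mul1mx//; exists x; rewrite ?mul1mx.
have := leb_affine 0 uAk m0; rewrite Delta1.
rewrite (_ : [set w | _] = B k); last first.
  by apply/seteqP; split => x; rewrite BkE /= DeltaE/= addr0.
have nX (z : R) m : `|z ^ m| = `|z| ^ m.
  by case: m => m; rewrite /exprz ?normfV normrX.
rewrite det_exprz nX => H.
have b0 := absdet_gt0.
rewrite -[LHS]mul1e -(_ : (b ^ k)%:E * (b ^ (- k))%:E = 1%E)%E; last first.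
  by rewrite -EFinM -expfzDr ?gt_eqF// subrr.
by rewrite -muleA H mule1.
Qed.

Lemma Bk_dilate k x : B k x -> B (k + 1) (r *: x).
Proof.
move=> [d Dd <-]; have [e De re] : mximage A Delta (r *: d) by apply: rDelta; exists d.
exists e => //; rewrite exprzDr ?unitmxE// expr1z -mulmxE -mulmxA re.
by rewrite scalemxAr.
Qed.

Lemma Bk_star k (t : R) x : `|t| <= 1 -> B k x -> B k (t *: x).
Proof.
rewrite !BkE => t1; rewrite -!scalemxAr enormZ; apply: le_lt_trans.
by rewrite ler_piMl// enorm_ge0.
Qed.

Let r0 : 0 < r. Proof. exact: lt_trans r1. Qed.

Lemma Bk_dilateX k (m : nat) x : B k x -> B (k + m%:Z) (r ^+ m *: x).
Proof.
elim: m x => [|m IH] x Bx; first by rewrite addr0 scale1r.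
by rewrite exprS -scalerA intS addrCA addrC; apply/Bk_dilate/IH.
Qed.

Lemma Bk_subS k : B k `<=` B (k + 1).
Proof.
move=> x /Bk_dilate/(@Bk_star _ r^-1); rewrite scalerA mulVf ?gt_eqF// scale1r; apply.
by rewrite gtr0_norm ?invr_gt0// invf_le1// ltW.
Qed.

Lemma Bk_sub k l : k <= l -> B k `<=` B l.
Proof.
move=> kl; have [m ->] : exists m : nat, l = k + m%:Z.
  by exists `|l - k|%N; rewrite gez0_abs ?subr_ge0// addrCA subrr addr0.
elim: m {kl} => [|m IH]; first by rewrite addr0.
apply: (subset_trans IH); rewrite intS addrCA addrC; exact: Bk_subS.
Qed.

Lemma Bk_0 k : B k 0.
Proof. by rewrite BkE !mulmx0 enorm0. Qed.

Lemma BkD : exists w : nat, forall k x y, B k x -> B k y -> B (k + w%:Z) (x + y).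
Proof.
have [w rw] := expr_unbounded 2 r1.
exists w => k x y Bx By.
have Bz : B k (r ^- w *: (x + y)).
  move: Bx By; rewrite !BkE => Bx By.
  rewrite -!scalemxAr enormZ !mulmxDr gtr0_norm ?invr_gt0 ?exprn_gt0//.
  rewrite mulrC ltr_pdivrMr ?exprn_gt0// mul1r (lt_trans _ rw)//.
  exact: enormD_lt2.
have := @Bk_dilateX _ w _ Bz.
by rewrite scalerA mulfV ?scale1r// expf_neq0// gt_eqF.
Qed.

Lemma Bk_ge (m : nat) x : enorm (P *m x) < r ^+ m -> B m x.
Proof.
move=> Px; have B0 : B 0 (r ^- m *: x).
  rewrite BkE oppr0 expr0z mul1mx -scalemxAr enormZ gtr0_norm ?invr_gt0 ?exprn_gt0//.
  by rewrite mulrC ltr_pdivrMr ?exprn_gt0// mul1r.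
have := @Bk_dilateX _ m _ B0.
by rewrite scalerA mulfV ?scale1r ?add0r// expf_neq0// gt_eqF.
Qed.

Lemma Bk_le (m : nat) x : B (- m%:Z) x -> enorm (P *m x) < r ^- m.
Proof.
move=> /(@Bk_dilateX _ m); rewrite addNr BkE oppr0 expr0z mul1mx -scalemxAr enormZ.
rewrite gtr0_norm ?exprn_gt0// => Px.
by rewrite -[ltRHS]mul1r ltr_pdivlMr ?exprn_gt0// mulrC.
Qed.

Lemma Bk_cover x : exists m : nat, B m x.
Proof. by have [m rm] := expr_unbounded (enorm (P *m x)) r1; exists m; exact: Bk_ge. Qed.

Lemma Bk_shrink (e : R) : 0 < e -> exists m : nat, forall x, B (- m%:Z) x -> enorm x < e.
Proof.
move=> e0; have [K K0 HK] := enorm_mulmx_bound (invmx P).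
have [m rm] := expr_unbounded (K / e) r1.
exists m => x /Bk_le Px.
have := HK (P *m x); rewrite mulKmx// => /le_lt_trans; apply.
apply: (@lt_trans _ _ (K * r ^- m)); first by rewrite ltr_pM2l.
by rewrite ltr_pdivrMr ?exprn_gt0// mulrC -ltr_pdivrMr.
Qed.

Lemma Bk_notin x : x != 0 -> exists m : nat, ~ B (- m%:Z) x.
Proof.
move=> x0; have ex : 0 < enorm x.
  rewrite lt_neqAle enorm_ge0 andbT eq_sym; apply: contraNneq x0 => /enorm_eq0 ->//.
have [m Bm] := Bk_shrink ex; exists m => /Bm; by rewrite ltxx.
Qed.

Lemma Bk_step x : x != 0 -> exists j, (B (j + 1) `\` B j) x.
Proof.
move=> x0; have [m' Bm'] := Bk_notin x0; have [m Bm] := Bk_cover x.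
have [i [Bi nBi]] : exists i : nat, B (- m'%:Z + i.+1%:Z) x /\ ~ B (- m'%:Z + i%:Z) x.
  apply: contrapT => H.
  have nB i : ~ B (- m'%:Z + i%:Z) x.
    elim: i => [|i IH]; first by rewrite addr0.
    by move=> Bi; apply: H; exists i.
  by apply: (nB (m' + m)%N); rewrite PoszD addrA addNr add0r.
by exists (- m'%:Z + i%:Z); split => //; rewrite -addrA [i%:Z + 1]addrC -intS.
Qed.

Lemma lmeasurable_Bk k : lmeasurable (B k).
Proof. by apply: borel_lmeasurable; exact: measurable_Bk. Qed.

Lemma lmeasurable_Ck k : lmeasurable (Ck A Delta k).
Proof. by apply: borel_lmeasurable; exact: measurable_Ck. Qed.

Lemma absdet_gt1 : 1 < b.
Proof.
have uM : ((r^-1)%:M : 'M[R]_n.+1) \in unitmx.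
  by rewrite unitmxE det_scalar unitrX// unitfE invr_neq0// gt_eqF.
have B0 : B 0 = Delta by rewrite Bk_lt1 oppr0 expr0z mulmx1 DeltaE.
have mD : measurable Delta by rewrite -B0; exact: measurable_Bk.
have mS := measurable_preimage_affine (r^-1)%:M 0 mD.
have := leb_affine 0 uM mD; rewrite Delta1 det_scalar normrX gtr0_norm ?invr_gt0// => H.
rewrite ltNge; apply/negP => b1.
have : (1 <= (r^-1 ^+ n.+1)%:E * leb R n.+1 (B 1))%E.
  rewrite -H lee_pmul2l// ?lte_fin ?exprn_gt0 ?invr_gt0//.
  apply: le_measure; rewrite ?inE; [exact: borel_lmeasurable..| |].
    exact: lmeasurable_Bk.
  move=> w /=; rewrite addr0 mul_scalar_mx => Dw.
  have /Bk_dilate : B 0 (r^-1 *: (w : 'cV[R]_n.+1)) by rewrite B0.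
  by rewrite add0r scalerA mulfV ?scale1r ?gt_eqF//.
rewrite leb_Bk expr1z -EFinM lee_fin leNgt => /negP; apply.
rewrite (@le_lt_trans _ _ (r^-1 ^+ n.+1))//.
  by rewrite ler_piMr// exprn_ge0// invr_ge0 ltW.
by rewrite exprn_ilt1// ?invr_ge0 ?ltW// invf_lt1.
Qed.

Let b0 := absdet_gt0.
Let b1 := absdet_gt1.

Lemma rhoE x : x != 0 -> exists2 j, rho A Delta x = b ^ j & (B (j + 1) `\` B j) x.
Proof.
move=> x0; rewrite /rho (negPf x0); eexists; first by [].
have [j Bj] := Bk_step x0.
exact: (@xgetPex _ 0 [set j | (B (j + 1) `\` B j) x] (ex_intro _ j Bj)).
Qed.

Lemma rho_lt_Bk k x : (rho A Delta x < b ^ k) <-> B k x.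
Proof.
have [->|x0] := eqVneq x 0.
  by rewrite /rho eqxx exprz_gt0//; split => // _; exact: Bk_0.
have [j -> [Bj1 nBj]] := rhoE x0; rewrite ltr_eXz2l//; split => [jk|Bk].
  by apply: Bk_sub Bj1; rewrite lezD1.
by rewrite ltNge; apply/negP => kj; apply: nBj; apply: Bk_sub Bk.
Qed.

Lemma balls_Bk k : balls A Delta (B k).
Proof.
exists 0, (b ^ k); split; first exact: exprz_gt0.
by apply/seteqP; split => x; rewrite /rho_ball/= subr0 rho_lt_Bk.
Qed.

Lemma rho_sub_ge : exists w : nat, forall k j x y, j + w%:Z <= k ->
  Ck A Delta k x -> B j y -> b ^ (k - w%:Z) <= rho A Delta (x - y).
Proof.
have [w Bw] := BkD; exists w.+1 => k j x y jk [Bx nBx] By.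
rewrite leNgt; apply/negP => /rho_lt_Bk Bxy; apply: nBx.
have -> : k - 1 = k - w.+1%:Z + w%:Z by rewrite intS; lia.
rewrite -(subrK y x); apply: Bw => //; apply: Bk_sub By; lia.
Qed.

Lemma leb_0 : leb R n.+1 [set 0] = 0%E.
Proof.
have m0 : lmeasurable [set (0 : 'cV[R]_n.+1)].
  apply: borel_lmeasurable; apply: closed_measurable_cV.
  rewrite (_ : [set 0] = [set x : 'cV[R]_n.+1 | enorm (1%:M *m x) <= 0]); first exact: closed_enorm_le.
  apply/seteqP; split => x /=; rewrite mul1mx; first by move=> ->; rewrite enorm0.
  by move=> x0; apply/enorm_eq0/eqP; rewrite eq_le x0 enorm_ge0.
apply/eqP; rewrite eq_le measure_ge0 andbT; apply/lee_addgt0Pr => e e0.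
have [m bm] := expr_unbounded e^-1 b1.
rewrite add0e (@le_trans _ _ (leb R n.+1 (B (- m%:Z))))//.
  apply: le_measure; rewrite ?inE//; first exact: lmeasurable_Bk.
  by move=> _ ->; exact: Bk_0.
rewrite leb_Bk lee_fin -invr_expz -[e]invrK lef_pV2 ?posrE ?invr_gt0 ?exprz_gt0//.
exact: ltW.
Qed.

Lemma supp_Bk (g : 'cV[R]_n.+1 -> R) k : (forall x, ~ B k x -> g x = 0) ->
  compact (supp g) /\ supp g `<=` B (k + 1).
Proof.
move=> gB; set M := P *m A ^ (- k).
have uM : M \in unitmx by rewrite unitmx_mul uP unitrXz.
pose K := [set x | enorm (M *m x) <= 1].
have cK : closed K by exact: closed_enorm_le.
have gK : supp g `<=` K.
  rewrite (_ : K = closure K); last by rewrite -(closure_id K).1.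
  apply: closure_subset => x /=; apply: contra_neqP => nK; apply: gB; apply: contra_not nK.
  by rewrite Bk_lt1; exact: ltW.
split.
  have [c c0 Hc] := enorm_mulmx_bound (invmx M).
  apply: (subclosed_compact (@closed_closure _ _) _ gK).
  apply: (@bounded_closed_compact_cV _ _ _ c) => // x Kx.
  by rewrite -(mulKmx uM x) (le_trans (Hc _))// ler_piMr// ltW.
apply: (subset_trans gK) => x Kx.
have /Bk_dilate : B k (r^-1 *: x).
  rewrite Bk_lt1/= -scalemxAr enormZ gtr0_norm ?invr_gt0//.
  by rewrite (le_lt_trans (ler_piMr _ Kx)) ?invf_lt1// invr_ge0 ltW.
by rewrite scalerA mulfV ?scale1r// gt_eqF.
Qed.

Lemma Ck_cover x : x != 0 -> exists k, Ck A Delta k x.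
Proof.
by move=> /Bk_step[j [Bj nBj]]; exists (j + 1); split => //; rewrite addrK.
Qed.

Lemma Ck_inj k l x : Ck A Delta k x -> Ck A Delta l x -> k = l.
Proof.
have H i j : Ck A Delta i x -> Ck A Delta j x -> j <= i.
  move=> [Bi _] [_ nBj]; rewrite leNgt; apply/negP => ij; apply: nBj.
  by apply: Bk_sub Bi; lia.
by move=> Ci Cj; apply/le_anti; rewrite !H.
Qed.

Lemma Ck_Bk k x : Ck A Delta k x -> B k x. Proof. by case. Qed.

Lemma Ck_neq0 k x : Ck A Delta k x -> x != 0.
Proof. by move=> [_ nB]; apply/eqP => x0; apply: nB; rewrite x0; exact: Bk_0. Qed.

Lemma Bk_growth : exists2 c : R, 0 < c & forall (m : nat) x,
  (~ B m x -> c * r ^+ m <= enorm x) /\ (B (- m%:Z) x -> enorm x <= c^-1 * r ^- m).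
Proof.
have [K K0 HK] := enorm_mulmx_bound P.
have [L L0 HL] := enorm_mulmx_bound (invmx P).
exists (K + L)^-1; first by rewrite invr_gt0 addr_gt0.
move=> m x; split.
  move=> nB; rewrite mulrC ler_pdivrMr ?addr_gt0//.
  have : r ^+ m <= enorm (P *m x) by rewrite leNgt; apply/negP => /Bk_ge.
  move/le_trans; apply; rewrite (le_trans (HK _))// mulrC ler_wpM2l ?enorm_ge0//.
  by rewrite lerDl ltW.
move=> /Bk_le/ltW Px; rewrite invrK -(mulKmx uP x) (le_trans (HL _))//.
by rewrite ler_pM ?enorm_ge0// ?ltW// ltrDr.
Qed.

Lemma compact_Bk_bound (E : set 'cV[R]_n.+1) : compact E ->
  exists m : nat, E `<=` B m.
Proof.
move=> /compact_bounded[M [_ HM]].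
have EM x : E x -> `|x| <= M + 1 by apply: HM; rewrite ltrDl.
have [K K0 HK] := enorm_mulmx_bound P.
have [m rm] := expr_unbounded (K * (n.+1%:R * (M + 1))) r1.
exists m => x Ex; apply: Bk_ge; rewrite (le_lt_trans _ rm)// (le_trans (HK _))//.
rewrite ler_wpM2l ?(ltW K0)// (le_trans (enorm_le_sum _))//.
rewrite (@le_trans _ _ (\sum_(i < n.+1) (M + 1)))//; last by rewrite sumr_const card_ord mulr_natl.
apply: ler_sum => i _; rewrite (le_trans _ (EM _ Ex))//.
change (`|x i ord0| <= mx_norm x); rewrite mx_normrE; apply/bigmax_geP; right => /=.
by exists (i, ord0).
Qed.

Lemma closed_Bk_away (E : set 'cV[R]_n.+1) : closed E -> ~ E 0 ->
  exists m : nat, forall x, E x -> ~ B (- m%:Z) x.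
Proof.
move=> cE nE0; have /nbhs_ballP[e /= e0 eE] : nbhs (0 : 'cV[R]_n.+1) (~` E).
  by apply: open_nbhs_nbhs; split => //; exact: closed_openC.
have [m Bm] := Bk_shrink e0; exists m => x Ex /Bm xe.
apply: (eE x) => //; rewrite -ball_normE /ball_/= sub0r normrN.
exact: le_lt_trans (normr_le_enorm x) xe.
Qed.

End anisotropic_balls.

(** * Luxemburg norms with a variable exponent *)

Local Open Scope ereal_scope.

Lemma ge0_le_integral_setT d (T : measurableType d) (R : realType)
    (mu : {measure set T -> \bar R}) (f g : T -> \bar R) :
  (forall x, 0 <= f x) -> (forall x, f x <= g x) ->
  \int[mu]_x f x <= \int[mu]_x g x.
Proof.
move=> f0 fg; have g0 x : 0 <= g x by exact: le_trans (fg x).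
rewrite !ge0_integralTE//; apply: ereal_sup_le => _ [h hf <-].
by exists h => // x; exact: le_trans (hf x) (fg x).
Qed.

Lemma le_poweR (R : realType) (r : R) (x y : \bar R) : (0 <= r)%R -> 0 <= x -> x <= y ->
  x `^ r <= y `^ r.
Proof.
move=> r0 x0 xy; apply: gt0_ler_poweR => //; rewrite in_itv/= leey andbT//.
exact: le_trans xy.
Qed.

Lemma poweRrV (R : realType) (r : R) (x : \bar R) : (r != 0)%R -> 0 <= x -> (x `^ r^-1) `^ r = x.
Proof. by move=> r0 x0; rewrite -poweRrM mulVf// poweRe1. Qed.

Lemma poweRVr (R : realType) (r : R) (x : \bar R) : (r != 0)%R -> 0 <= x -> (x `^ r) `^ r^-1 = x.
Proof. by move=> r0 x0; rewrite -poweRrM mulfV// poweRe1. Qed.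

Lemma measurable_poweR_fun d (T : measurableType d) (R : realType)
    (f : T -> \bar R) (q : T -> R) :
  measurable_fun setT f -> measurable_fun setT q -> (forall x, 0 <= f x) ->
  measurable_fun setT (fun x => f x `^ q x).
Proof.
move=> mf mq f0.
have mfine : measurable_fun setT (fun x => fine (f x)).
  by apply: measurableT_comp => //; exact: measurable_fine.
rewrite (_ : (fun _ => _) = fun x => if q x == 0%R then 1 else if f x == +oo then +oo else
  (if fine (f x) == 0%R then 0%R else expR (q x * ln (fine (f x))))%:E); last first.
  apply/funext => x; rewrite poweRE; case: ifPn => [/eqP ->|qn].
    by rewrite powRr0; case: ifP.
  case: eqP => // _; rewrite gt_eqF; last exact: lt_le_trans (f0 x).
  have [->|fx0] := eqVneq (fine (f x)) 0%R; first by rewrite powR0.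
  by rewrite /powR (negPf fx0).
apply: measurable_fun_ifT => //; first exact: measurable_fun_eqr.
apply: measurable_fun_ifT => //; first by apply: measurable_fun_eqe.
apply/measurable_EFinP; apply: measurable_fun_ifT => //.
  exact: measurable_fun_eqr.
apply: measurableT_comp => //; apply: measurable_funM => //.
by apply: measurableT_comp mfine; exact: measurable_ln.
Qed.

Section luxemburg.
Context d {T : measurableType d} {R : realType} (mu : {measure set T -> \bar R}).
Implicit Types (q : T -> R) (g : T -> \bar R).

Definition modular q g (l : R) := \int[mu]_x ((`|g x| * (l^-1)%:E) `^ q x).

Definition luxemburg q g :=
  ereal_inf [set l%:E | l in [set l : R | (0 < l)%R /\ modular q g l <= 1]].

End luxemburg.

Section luxemburg_norm.
Context d {T : measurableType d} {R : realType} (mu : {measure set T -> \bar R}).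
Variable q : T -> R.
Hypothesis q0 : (forall x, 0 <= q x)%R.
Implicit Types (f g : T -> \bar R) (l c : R).
Local Notation modular := (modular mu q).
Local Notation lux := (luxemburg mu q).

Lemma luxemburg_le_modular g l : (0 < l)%R -> modular g l <= 1 -> lux g <= l%:E.
Proof. by move=> l0 gl; apply: ereal_inf_lbound; exists l. Qed.

Lemma luxemburg_ge0 g : 0 <= lux g.
Proof. by apply: le_ereal_inf_tmp => _ [l [l0 _] <-]; rewrite lee_fin ltW. Qed.

Lemma le_modular f g l : (0 < l)%R -> (forall x, `|f x| <= `|g x|) -> modular f l <= modular g l.
Proof.
move=> l0 fg; apply: ge0_le_integral_setT => x; first exact: poweR_ge0.
apply: le_poweR => //.
  by rewrite mule_ge0// lee_fin invr_ge0 ltW.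
by rewrite lee_wpmul2r// lee_fin invr_ge0 ltW.
Qed.

Lemma luxemburg_lt g l : lux g < l%:E -> (0 < l)%R /\ modular g l <= 1.
Proof.
move=> /ereal_inf_lt[_ [a [a0 ga] <-]]; rewrite lte_fin => al.
have l0 := lt_trans a0 al; split; [exact: l0|apply: le_trans ga].
apply: ge0_le_integral_setT => x; first exact: poweR_ge0.
apply: le_poweR => //.
  by rewrite mule_ge0// lee_fin invr_ge0 ltW.
by rewrite lee_wpmul2l// lee_fin lef_pV2// ltW.
Qed.

Lemma le_luxemburg f g : (forall x, `|f x| <= `|g x|) -> lux f <= lux g.
Proof.
move=> fg; apply: le_ereal_inf_tmp => _ [l [l0 gl] <-].
by apply: luxemburg_le_modular => //; apply: le_trans gl; exact: le_modular.
Qed.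

Lemma luxemburgZ_le c g : (0 < c)%R -> lux (fun x => c%:E * g x) <= c%:E * lux g.
Proof.
move=> c0; rewrite muleC -lee_pdivrMr//; apply: le_ereal_inf_tmp => _ [l [l0 gl] <-].
rewrite lee_pdivrMr// -EFinM; apply: luxemburg_le_modular; first exact: mulr_gt0.
apply: le_trans gl; rewrite le_eqVlt; apply/orP; left; apply/eqP.
apply: eq_integral => x _; congr (_ `^ _).
by rewrite abseM/= gtr0_norm// invfM mulrC EFinM muleACA -EFinM divff ?gt_eqF// mul1e.
Qed.

Lemma measurable_modular g l : (0 < l)%R -> measurable_fun setT q -> measurable_fun setT g ->
  measurable_fun setT (fun x => (`|g x| * (l^-1)%:E) `^ q x).
Proof.
move=> l0 mq mg; apply: measurable_poweR_fun => //; last first.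
  by move=> x; rewrite mule_ge0// lee_fin invr_ge0 ltW.
by apply: emeasurable_funM; [exact: measurableT_comp|exact: measurable_cst].
Qed.

End luxemburg_norm.

Lemma lee_add_inf (R : realType) (x : \bar R) (X Y : set \bar R) :
  (forall a, X a -> 0 <= a) -> (forall b, Y b -> 0 <= b) ->
  (forall a b, X a -> Y b -> x <= a + b) -> x <= ereal_inf X + ereal_inf Y.
Proof.
move=> X0 Y0 XY.
have iX0 : 0 <= ereal_inf X by exact: le_ereal_inf_tmp.
have iY0 : 0 <= ereal_inf Y by exact: le_ereal_inf_tmp.
have [->|Xoo] := eqVneq (ereal_inf X) +oo; first by rewrite addye ?leey// gt_eqF// (lt_le_trans _ iY0).
have [->|Yoo] := eqVneq (ereal_inf Y) +oo; first by rewrite addey ?leey// gt_eqF// (lt_le_trans _ iX0).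
have fX : ereal_inf X \is a fin_num by rewrite ge0_fin_numE// lt_neqAle Xoo leey.
have fY : ereal_inf Y \is a fin_num by rewrite ge0_fin_numE// lt_neqAle Yoo leey.
apply/lee_addgt0Pr => e e0; have e20 : (0 < e / 2)%R by rewrite divr_gt0.
have [a Xa ae] := lb_ereal_inf_adherent e20 fX.
have [b Yb be] := lb_ereal_inf_adherent e20 fY.
apply: le_trans (XY _ _ Xa Yb) _; rewrite (splitr e) EFinD addeACA.
by apply: leeD; exact: ltW.
Qed.

Lemma powR_convex (R : realType) (x y t p : R) : (1 <= p)%R -> (0 <= t <= 1)%R ->
  (0 <= x)%R -> (0 <= y)%R ->
  ((t * x + (1 - t) * y) `^ p <= t * x `^ p + (1 - t) * y `^ p)%R.
Proof.
move=> p1 /andP[t0 t1] x0 y0.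
have := @convex_powR R p p1 (Itv01 t0 t1) x y.
by rewrite !inE/= !in_itv/= x0 y0 => /(_ isT isT); rewrite !convRE.
Qed.

Lemma poweR_convex (R : realType) (a b : R) (x y : \bar R) (p : R) :
  (1 <= p)%R -> (0 < a)%R -> (0 < b)%R -> 0 <= x -> 0 <= y ->
  ((x + y) * ((a + b)^-1)%:E) `^ p <=
  (a / (a + b))%:E * (x * (a^-1)%:E) `^ p + (b / (a + b))%:E * (y * (b^-1)%:E) `^ p.
Proof.
move=> p1 a0 b0; have p0 : (0 < p)%R by exact: lt_le_trans p1.
have ab0 : (0 < a + b)%R by exact: addr_gt0.
have iab : (0 < a / (a + b))%R by exact: divr_gt0.
have iba : (0 < b / (a + b))%R by exact: divr_gt0.
have pn0 : (p != 0)%R by rewrite gt_eqF.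
have H (c t : R) : (0 < c)%R -> (0 < t)%R -> c%:E * (+oo * (t^-1)%:E) `^ p = +oo.
  by move=> c0 t0; rewrite gt0_mulye ?lte_fin ?invr_gt0// poweRyr// gt0_muley// lte_fin.
have pos c (z : \bar R) t : (0 < c)%R -> 0 <= c%:E * (z * t) `^ p.
  by move=> c0; rewrite mule_ge0 ?poweR_ge0// lee_fin ltW.
move=> x0 y0; have [->|xoo] := eqVneq x +oo.
  by rewrite H// [leRHS]addye ?leey// gt_eqF// (lt_le_trans _ (pos _ _ _ _)).
have [->|yoo] := eqVneq y +oo.
  by rewrite H// [leRHS]addey ?leey// gt_eqF// (lt_le_trans _ (pos _ _ _ _)).
have {xoo} : x \is a fin_num by rewrite ge0_fin_numE// lt_neqAle xoo leey.
have {yoo} : y \is a fin_num by rewrite ge0_fin_numE// lt_neqAle yoo leey.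
case: y y0 => //= y y0 _; case: x x0 => //= x x0 _; rewrite !lee_fin in x0 y0 *.
have -> : (b / (a + b) = 1 - a / (a + b))%R by field; rewrite gt_eqF.
have -> : ((x + y) / (a + b) = a / (a + b) * (x / a) + (1 - a / (a + b)) * (y / b))%R.
  by field; rewrite !gt_eqF.
apply: powR_convex => //; [|by rewrite divr_ge0// ltW..].
by rewrite ltW//= ler_pdivrMr// mul1r lerDl ltW.
Qed.

Section luxemburg_norm_ge1.
Context d {T : measurableType d} {R : realType} (mu : {measure set T -> \bar R}).
Variable q : T -> R.
Hypotheses (q1 : (forall x, 1 <= q x)%R) (mq : measurable_fun setT q).
Implicit Types (f g : T -> \bar R) (l c : R).
Local Notation modular := (modular mu q).
Local Notation lux := (luxemburg mu q).

Let q0 x : (0 < q x)%R. Proof. exact: lt_le_trans (q1 x). Qed.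
Let q0' x : (0 <= q x)%R. Proof. exact: ltW. Qed.
Let qn0 x : (q x != 0)%R. Proof. by rewrite gt_eqF. Qed.

Lemma ae_le_luxemburg f g : measurable_fun setT f -> measurable_fun setT g ->
  {ae mu, forall x, `|f x| <= `|g x|} -> lux f <= lux g.
Proof.
move=> mf mg fg; apply: le_ereal_inf_tmp => _ [l [l0 gl] <-].
apply: (luxemburg_le_modular l0); apply: le_trans gl.
apply: ae_ge0_le_integral; [exact: measurableT| |exact: measurable_modular| |exact: measurable_modular|].
- by move=> x _; exact: poweR_ge0.
- by move=> x _; exact: poweR_ge0.
apply: filterS fg => x fg _; apply: (le_poweR (q0' x)).
  by rewrite mule_ge0// lee_fin invr_ge0 ltW.
by rewrite lee_wpmul2r// lee_fin invr_ge0 ltW.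
Qed.

Lemma luxemburgD f g : measurable_fun setT f -> measurable_fun setT g -> (forall x, 0 <= f x) -> (forall x, 0 <= g x) ->
  lux (fun x => f x + g x) <= lux f + lux g.
Proof.
move=> mf mg f0 g0; apply: lee_add_inf.
- by move=> _ [l [l0 _] <-]; rewrite lee_fin ltW.
- by move=> _ [l [l0 _] <-]; rewrite lee_fin ltW.
move=> _ _ [a [a0 fa] <-] [b [b0 gb] <-].
have ab0 : (0 < a + b)%R by exact: addr_gt0.
have iab : (0 <= a / (a + b))%R by rewrite divr_ge0// ltW.
have iba : (0 <= b / (a + b))%R by rewrite divr_ge0// ltW.
rewrite -EFinD; apply: luxemburg_le_modular => //.
apply: (@le_trans _ _ ((a / (a + b))%:E * modular f a + (b / (a + b))%:E * modular g b)).
  rewrite /modular -!ge0_integralZl//=; last 4 first.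
  - exact: measurable_modular.
  - by move=> x _; exact: poweR_ge0.
  - exact: measurable_modular.
  - by move=> x _; exact: poweR_ge0.
  rewrite -ge0_integralD//=; last 4 first.
  - by move=> x _; rewrite mule_ge0// poweR_ge0.
  - by apply: emeasurable_funM => //; exact: measurable_modular.
  - by move=> x _; rewrite mule_ge0// poweR_ge0.
  - by apply: emeasurable_funM => //; exact: measurable_modular.
  apply: ge0_le_integral_setT => x; first exact: poweR_ge0.
  rewrite (gee0_abs (adde_ge0 (f0 x) (g0 x))) (gee0_abs (f0 x)) (gee0_abs (g0 x)).
  by apply: poweR_convex.
have -> : 1 = (a / (a + b))%:E * 1 + (b / (a + b))%:E * 1 :> \bar R.
  by rewrite !mule1 -EFinD -mulrDl divff ?gt_eqF.
by apply: leeD; rewrite lee_wpmul2l// lee_fin.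
Qed.

Lemma luxemburg_fatou (g : nat -> T -> \bar R) (L : \bar R) :
  (forall k, measurable_fun setT (g k)) -> (forall k x, 0 <= g k x) ->
  (forall x, nondecreasing_seq (g ^~ x)) -> (forall k, lux (g k) <= L) ->
  lux (fun x => limn (g ^~ x)) <= L.
Proof.
move=> mg g0 ndg gL; have L0 : 0 <= L by apply: le_trans (gL 0%N); exact: luxemburg_ge0.
have [->|Loo] := eqVneq L +oo; first by rewrite leey.
have fL : L \is a fin_num by rewrite ge0_fin_numE// lt_neqAle Loo leey.
apply/lee_addgt0Pr => e e0; rewrite -(fineK fL) -EFinD; set l := (fine L + e)%R.
have gl k : (0 < l)%R /\ modular (g k) l <= 1.
  apply: luxemburg_lt => //; apply: le_lt_trans (gL k) _.
  by rewrite -[ltLHS](fineK fL) lte_fin ltrDl.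
have l0 : (0 < l)%R := (gl 0%N).1.
have il0 : (0 <= l^-1)%R by rewrite invr_ge0 ltW.
apply: luxemburg_le_modular => //.
pose h k x := (`|g k x| * (l^-1)%:E) `^ q x.
have ndh x : nondecreasing_seq (h ^~ x).
  move=> i j ij; apply: (le_poweR (q0' x)); first by rewrite mule_ge0.
  by rewrite lee_wpmul2r// !gee0_abs//; exact: ndg.
have cg x : cvgn (g ^~ x) by exact: ereal_nondecreasing_is_cvgn.
have ch x : cvgn (h ^~ x) by exact: ereal_nondecreasing_is_cvgn.
apply: (@le_trans _ _ (\int[mu]_x limn (h ^~ x))).
  apply: ge0_le_integral_setT => x; first exact: poweR_ge0.
  have h0 : 0 <= limn (h ^~ x) by apply: lime_ge => //; apply: nearW => k; exact: poweR_ge0.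
  have lg0 : 0 <= limn (g ^~ x) by apply: lime_ge => //; apply: nearW.
  rewrite -[leRHS](@poweRrV _ (q x)) ?qn0//; apply: (le_poweR (q0' x)).
    by rewrite mule_ge0.
  rewrite gee0_abs// -lee_pdivlMr ?invr_gt0// invrK.
  apply: lime_le => //; apply: nearW => k.
  have -> : g k x = (h k x) `^ (q x)^-1 * l%:E.
    by rewrite poweRVr ?qn0 ?mule_ge0// gee0_abs// -muleA -EFinM mulVf ?gt_eqF// mule1.
  rewrite lee_wpmul2r ?lee_fin ?(ltW l0)//; apply: le_poweR; first by rewrite invr_ge0 q0'.
    exact: poweR_ge0.
  move/cvg_lim : (ereal_nondecreasing_cvgn (ndh x)) => -> //.
  by apply: ereal_sup_ubound; exists k.
rewrite monotone_convergence; [|exact: measurableT|by move=> k; exact: measurable_modular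
  |by move=> k x _; exact: poweR_ge0|by move=> x _; exact: ndh].
apply: lime_le.
  apply: ereal_nondecreasing_is_cvgn => i j ij; apply: ge0_le_integral_setT => x.
    exact: poweR_ge0.
  exact: ndh.
by apply: nearW => k; exact: (gl k).2.
Qed.

Lemma luxemburg0 : lux (cst 0) = 0.
Proof.
apply/eqP; rewrite eq_le luxemburg_ge0// andbT; apply/lee_addgt0Pr => e e0; rewrite add0e.
apply: luxemburg_le_modular => //; rewrite /modular (eq_integral (cst 0)) ?integral0 ?lee01//.
by move=> x _; rewrite abse0 mul0e poweR0r ?qn0.
Qed.

Lemma luxemburg_nneseries (g : nat -> T -> \bar R) :
  (forall k, measurable_fun setT (g k)) -> (forall k x, 0 <= g k x) ->
  lux (fun x => \sum_(0 <= k <oo) g k x) <= \sum_(0 <= k <oo) lux (g k).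
Proof.
move=> mg g0.
have mS m : measurable_fun setT (fun x => \sum_(0 <= k < m) g k x) by exact: emeasurable_sum.
apply: luxemburg_fatou => //.
- by move=> m x; rewrite sume_ge0.
- by move=> x; by apply: ereal_nondecreasing_series => k _ _; exact: g0.
move=> m; apply: (@le_trans _ _ (\sum_(0 <= k < m) lux (g k))); last first.
  by apply: nneseries_lim_ge => k _ _; exact: luxemburg_ge0.
elim: m => [|m IH].
  rewrite big_geq// (_ : (fun _ => _) = cst 0) ?luxemburg0//.
  by apply/funext => x; rewrite big_geq.
rewrite big_nat_recr//=; under [X in lux X]eq_fun do rewrite big_nat_recr//=.
apply: le_trans (luxemburgD (mS m) (mg m) _ (g0 m)) _; first by move=> x; rewrite sume_ge0.
exact: leeD.
Qed.

End luxemburg_norm_ge1.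

Lemma ess_inf_gt1 d (T : measurableType d) (R : realType)
    (mu : {measure set T -> \bar R}) (q : T -> R) :
  (1 < ess_inf mu (EFin \o q : T -> \bar R))%E -> exists2 c : R, (1 < c)%R & {ae mu, forall x, (c <= q x)%R}.
Proof.
move=> /ereal_sup_gt[y /= yq y1].
case: y yq y1 => [c| |]// yq y1; first by exists c => //; rewrite -lte_fin.
exists 2%R; first by rewrite ltr1n.
apply: filterS yq => x; by rewrite leye_eq.
Qed.

Section indicator_norm.
Context d {T : measurableType d} {R : realType} (mu : {measure set T -> \bar R}).
Variables (s : T -> R) (Q : R) (S : set T).
Hypotheses (s0 : (forall x, 0 <= s x)%R) (ms : measurable_fun setT s)
  (sQ : {ae mu, forall x, (1 <= s x <= Q)%R}) (mS : measurable S).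
Local Notation chi := (EFin \o (\1_S : T -> R)).
Local Notation lux := (luxemburg mu s).

Let mchi : measurable_fun setT chi.
Proof. by apply/measurable_EFinP; exact: measurable_indic. Qed.

Let mmod l : (0 < l)%R -> measurable_fun setT (fun x => (`|chi x| * (l^-1)%:E) `^ s x).
Proof. by move=> l0; exact: measurable_modular. Qed.

Let int_chi (c : R) : (0 <= c)%R -> \int[mu]_x (c%:E * chi x) = c%:E * mu S.
Proof.
move=> c0; rewrite ge0_integralZl//; last by move=> x _; rewrite lee_fin.
by rewrite integral_indic// setIT.
Qed.

Let mcchi (c : R) : measurable_fun setT (fun x => c%:E * chi x).
Proof. by apply: emeasurable_funM => //; exact: measurable_cst. Qed.

Lemma modular_indic_le l (c : R) : (0 < l)%R -> (0 <= c)%R ->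
  (forall r, (1 <= r <= Q)%R -> ((l^-1) `^ r <= c)%R) ->
  modular mu s chi l <= c%:E * mu S.
Proof.
move=> l0 c0 lc; rewrite -int_chi//.
apply: ae_ge0_le_integral; first exact: measurableT.
- by move=> x _; exact: poweR_ge0.
- exact: mmod.
- by move=> x _; rewrite mule_ge0// lee_fin.
- exact: mcchi.
apply: filterS sQ => x /andP[s1 sQx] _ /=; rewrite indicE.
case: (x \in S); rewrite ?normr1 ?normr0 ?mul1r ?mulr1 ?mulr0 ?mul1e ?mule1 ?mule0 ?mul0e.
  by rewrite lee_fin lc// s1.
by rewrite ?mul0r powR0// gt_eqF// (lt_le_trans _ s1).
Qed.

Lemma modular_indic_ge l : (0 < l <= 1)%R -> (l^-1)%:E * mu S <= modular mu s chi l.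
Proof.
move=> /andP[l0 l1]; rewrite -int_chi; last by rewrite invr_ge0 ltW.
apply: ae_ge0_le_integral; first exact: measurableT.
- by move=> x _; rewrite mule_ge0// lee_fin// invr_ge0 ltW.
- exact: mcchi.
- by move=> x _; exact: poweR_ge0.
- exact: mmod.
apply: filterS sQ => x /andP[s1 sQx] _ /=; rewrite indicE.
case: (x \in S); rewrite ?normr1 ?normr0 ?mul1r ?mulr1 ?mulr0 ?mul1e ?mule1 ?mule0 ?mul0e.
  by rewrite lee_fin le1r_powR// invf_ge1.
by rewrite lee_fin powR_ge0.
Qed.

Hypotheses (muS0 : 0 < mu S) (muSoo : mu S < +oo).
Let fS : mu S \is a fin_num. Proof. by rewrite ge0_fin_numE. Qed.
Let muS : mu S = (fine (mu S))%:E. Proof. by rewrite fineK. Qed.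
Let fmuS0 : (0 < fine (mu S))%R. Proof. by rewrite -lte_fin -muS. Qed.

Lemma luxemburg_indic_lty : lux chi < +oo.
Proof.
pose l := (1 + fine (mu S))%R; have l1 : (1 <= l)%R by rewrite lerDl ltW.
have l0 : (0 < l)%R by exact: lt_le_trans l1.
apply: (@le_lt_trans _ _ l%:E); last exact: ltry.
apply: luxemburg_le_modular => //.
apply: (@le_trans _ _ ((l^-1)%:E * mu S)).
  apply: modular_indic_le => //; first by rewrite invr_ge0 ltW.
  by move=> r /andP[r1 _]; rewrite ge1r_powR// invr_gt0 l0 invf_le1.
by rewrite muS -EFinM lee_fin mulrC ler_pdivrMr// mul1r lerDr.
Qed.

Lemma luxemburg_indic_gt0 : 0 < lux chi.
Proof.
pose l := Num.min 1%R (fine (mu S) / 2)%R.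
have l0 : (0 < l)%R by rewrite lt_min ltr01 divr_gt0.
apply: (@lt_le_trans _ _ l%:E); first by rewrite lte_fin.
rewrite leNgt; apply/negP => /(luxemburg_lt s0)[_].
rewrite leNgt => /negP; apply; apply: (@lt_le_trans _ _ ((l^-1)%:E * mu S)).
  rewrite muS -EFinM lte_fin mulrC ltr_pdivlMr// mul1r.
  by rewrite gt_min (ltr_pdivrMr _ _ (ltr0Sn _ _)) ltr_pMr// ltr1n orbT.
by apply: modular_indic_ge; rewrite l0 ge_min lexx.
Qed.

Lemma modular_indic_lty l : (0 < l)%R -> modular mu s chi l < +oo.
Proof.
move=> l0; have c0 : (0 <= 1 + (l^-1) `^ Q)%R by rewrite addr_ge0// powR_ge0.
apply: (@le_lt_trans _ _ ((1 + (l^-1) `^ Q)%:E * mu S)).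
  apply: modular_indic_le => // r /andP[r1 rQ].
  have [l1|l1] := leP 1%R (l^-1)%R.
    by rewrite (le_trans (ler_powR l1 rQ))// lerDr.
  rewrite (@le_trans _ _ 1%R)//; last by rewrite lerDl powR_ge0.
  rewrite -(powRr0 (l^-1)%R) ger_powR ?invr_gt0 ?l0 ?ltW//.
  exact: lt_le_trans r1.
by rewrite muS -EFinM ltry.
Qed.

End indicator_norm.

Section duality.
Context d {T : measurableType d} {R : realType} (mu : {measure set T -> \bar R}).
Variables (q : T -> R) (c : R).
Hypotheses (q1 : (forall x, 1 <= q x)%R) (mq : measurable_fun setT q)
  (c1 : (1 < c)%R) (cq : {ae mu, forall x, (c <= q x)%R}).
Definition conjugate : T -> R := fun x => (q x / (q x - 1))%R.
Local Notation q' := conjugate.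

Lemma conjugate_ge0 x : (0 <= q' x)%R.
Proof. by rewrite divr_ge0// ?subr_ge0// (le_trans ler01). Qed.

Lemma measurable_conjugate : measurable_fun setT q'.
Proof.
rewrite (_ : q' = fun x => (q x * (q x - 1) `^ (-1))%R); last first.
  by apply/funext => x; rewrite powR_inv1 ?subr_ge0.
have m1 : measurable_fun setT (fun x => q x - 1)%R by exact: measurable_funB.
apply: measurable_funM => //.
exact: (measurableT_comp (measurable_powR (-1)) m1).
Qed.

Lemma conjugate_bound : {ae mu, forall x, (1 <= q' x <= c / (c - 1))%R}.
Proof.
apply: filterS cq => x cqx; have q1x : (0 < q x - 1)%R by rewrite subr_gt0 (lt_le_trans c1).
have c10 : (0 < c - 1)%R by rewrite subr_gt0.
rewrite /q' ler_pdivlMr// mul1r gerBl ler01/= ler_pdivrMr// mulrAC ler_pdivlMr//.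
by rewrite !mulrBr !mulr1 mulrC lerB.
Qed.

Lemma holder_indic (f : T -> R) (S : set T) (l : R) :
  measurable_fun setT f -> measurable S -> (0 < l)%R ->
  modular mu q' (EFin \o \1_S) l <= 1 ->
  \int[mu]_x (`|f x| * \1_S x)%:E <= (2 * l)%:E * luxemburg mu q (EFin \o f).
Proof.
move=> mf mS l0 Sl.
have l20 : (0 < 2 * l)%R by exact: mulr_gt0.
rewrite muleC -lee_pdivrMr//; apply: le_ereal_inf_tmp => _ [a [a0 fa] <-].
rewrite lee_pdivrMr//.
have mf' : measurable_fun setT (EFin \o f) by exact/measurable_EFinP.
have mS' : measurable_fun setT (EFin \o (\1_S : T -> R)).
  by apply/measurable_EFinP; exact: measurable_indic.
have mX : measurable_fun setT (fun x => (`|(EFin \o f) x| * (a^-1)%:E) `^ q x).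
  exact: measurable_modular.
have mY : measurable_fun setT (fun x => (`|(EFin \o (\1_S : T -> R)) x| * (l^-1)%:E) `^ q' x).
  by apply: measurable_modular => //; exact: measurable_conjugate.
apply: (@le_trans _ _ ((a * l)%:E * (modular mu q (EFin \o f) a + modular mu q' (EFin \o \1_S) l))); last first.
  rewrite [leRHS](_ : _ = (a * l)%:E * (1 + 1)); last first.
    by rewrite -EFinD -!EFinM; congr EFin; ring.
  by apply: lee_wpmul2l; [rewrite lee_fin mulr_ge0// ltW|exact: (leeD fa Sl)].
rewrite /modular -ge0_integralD//; [|by move=> x _; exact: poweR_ge0|by move=> x _; exact: poweR_ge0].
rewrite -ge0_integralZl//; last 3 first.
- exact: emeasurable_funD.
- by move=> x _; rewrite adde_ge0// poweR_ge0.
- by rewrite lee_fin mulr_ge0// ltW.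
apply: ae_ge0_le_integral; first exact: measurableT.
- by move=> x _; rewrite lee_fin mulr_ge0.
- by apply/measurable_EFinP; exact: (measurable_funM (measurableT_comp (@normr_measurable R setT) mf) (measurable_indic mS)).
- by move=> x _; rewrite mule_ge0 ?adde_ge0 ?poweR_ge0// lee_fin mulr_ge0// ltW.
- by apply: emeasurable_funM; [exact: measurable_cst|exact: emeasurable_funD].
apply: filterS cq => x cqx _; have qx1 : (1 < q x)%R by exact: lt_le_trans cqx.
have qx0 : (0 < q x)%R by exact: lt_trans qx1.
have q10 : (0 < q x - 1)%R by rewrite subr_gt0.
have q'0 : (0 < q' x)%R by exact: divr_gt0.
have q'1 : (1 <= q' x)%R by rewrite /q' ler_pdivlMr// mul1r gerBl.
rewrite /= -EFinM lee_fin.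
have fa0 : (0 <= `|f x| / a)%R by rewrite divr_ge0// ltW.
have Sl0 : (0 <= `|\1_S x : R| / l)%R by rewrite divr_ge0// ltW.
have e : ((q x)^-1 + (q' x)^-1 = 1)%R by rewrite /q' invf_div; field; rewrite gt_eqF.
have H := conjugate_powR fa0 Sl0 qx0 q'0 e.
have -> : (`|f x| * \1_S x = a * l * (`|f x| / a * (`|\1_S x : R| / l)))%R.
  by rewrite (ger0_norm (_ : (0 <= \1_S x :> R)%R))//; field; rewrite !gt_eqF.
rewrite ler_pM2l ?mulr_gt0// (le_trans H)//; apply: lerD.
  by rewrite ler_pdivrMr// ler_peMr ?powR_ge0// ltW.
by rewrite ler_pdivrMr// ler_peMr ?powR_ge0.
Qed.

(* [f] is the near-extremal function [(1_S / l)^(q' - 1)] for [l] half the norm of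
   [1_S]. *)
Lemma luxemburg_dual (S : set T) : measurable S -> 0 < mu S -> mu S < +oo ->
  exists (f : T -> R) (I : R), [/\ measurable_fun setT f, (0 < I)%R,
    luxemburg mu q (EFin \o f) <= I%:E &
    \int[mu]_(x in S) `|f x|%:E =
      (fine (luxemburg mu q' (EFin \o \1_S)) / 2 * I)%:E].
Proof.
move=> mS S0 Soo.
have q'0 := conjugate_ge0; have mq' := measurable_conjugate.
have q'Q := conjugate_bound.
have b0 : 0 < luxemburg mu q' (EFin \o \1_S) by exact: (luxemburg_indic_gt0 _ _ q'Q).
have boo : luxemburg mu q' (EFin \o \1_S) < +oo by exact: (luxemburg_indic_lty _ q'Q).
set beta := luxemburg mu q' _ in b0 boo *.
have fb : beta \is a fin_num by rewrite ge0_fin_numE// ltW.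
have fb0 : (0 < fine beta)%R by rewrite -lte_fin fineK.
set l := (fine beta / 2)%R; have l0 : (0 < l)%R by rewrite divr_gt0.
have il0 : (0 <= l^-1)%R by rewrite invr_ge0 ltW.
have modl1 : 1 < modular mu q' (EFin \o \1_S) l.
  rewrite ltNge; apply/negP => /(luxemburg_le_modular l0).
  rewrite -/beta -(fineK fb) lee_fin leNgt => /negP; apply.
  by rewrite ltr_pdivrMr// ltr_pMr// ltr1n.
have modoo : modular mu q' (EFin \o \1_S) l < +oo by exact: (modular_indic_lty _ q'Q).
set J := modular _ _ _ _ in modl1 modoo.
have fJ : J \is a fin_num by rewrite ge0_fin_numE// (le_trans _ (ltW modl1)).
set I := fine J; have JE : J = I%:E by rewrite fineK.
have I1 : (1 < I)%R by rewrite -lte_fin -JE.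
have I0 : (0 < I)%R by exact: lt_trans I1.
pose f x : R := (\1_S x * (l^-1) `^ (q' x - 1))%R.
have f0 x : (0 <= f x)%R by rewrite mulr_ge0// powR_ge0.
have mf : measurable_fun setT f.
  apply: measurable_funM; first exact: measurable_indic.
  by apply: (measurableT_comp (measurable_powRr (l^-1)%R)); exact: measurable_funB.
have mS' : measurable_fun setT (EFin \o (\1_S : T -> R)).
  by apply/measurable_EFinP; exact: measurable_indic.
have mJ : measurable_fun setT (fun x => (`|(EFin \o (\1_S : T -> R)) x| * (l^-1)%:E) `^ q' x).
  exact: measurable_modular.
exists f, I; split => //.
- apply: luxemburg_le_modular => //.
  rewrite [leRHS](_ : 1 = (I^-1)%:E * J); last by rewrite JE -EFinM mulVf// gt_eqF.
  rewrite /J /modular -ge0_integralZl//; last 2 first.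
  - by move=> x _; exact: poweR_ge0.
  - by rewrite lee_fin invr_ge0 ltW.
  apply: ae_ge0_le_integral; first exact: measurableT.
  - by move=> x _; exact: poweR_ge0.
  - by apply: measurable_modular => //; exact/measurable_EFinP.
  - by move=> x _; rewrite mule_ge0 ?poweR_ge0// lee_fin invr_ge0 ltW.
  - by apply: emeasurable_funM; [exact: measurable_cst|].
  apply: filterS2 cq q'Q => x cqx /andP[q'1 _] _.
  have qx1 : (1 < q x)%R by exact: lt_le_trans cqx.
  have qx0 : (0 < q x)%R by exact: lt_trans qx1.
  rewrite /= -EFinM lee_fin (ger0_norm (f0 x)) powRM ?invr_ge0 ?(ltW I0)// mulrC.
  rewrite ler_pM ?powR_ge0//.
    by rewrite ge1r_powR// ?(ltW qx1)// invr_gt0 I0 invf_le1// ltW.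
  rewrite /f indicE; case: (x \in S) => /=; last first.
    by rewrite normr0 !mul0r !powR0// gt_eqF// (lt_le_trans _ q'1).
  rewrite normr1 !mul1r -powRrM le_eqVlt; apply/orP; left; apply/eqP; congr (_ `^ _)%R.
  by rewrite /q'; field; rewrite gt_eqF// subr_gt0.
rewrite integral_mkcond.
transitivity (\int[mu]_x (l%:E * (`|(EFin \o (\1_S : T -> R)) x| * (l^-1)%:E) `^ q' x)).
  apply: ae_eq_integral => //.
  - apply: (measurable_restrictT _ _).1 => //.
    by apply/measurable_EFinP; apply: measurable_funTS; exact: measurableT_comp.
  - by apply: emeasurable_funM; [exact: measurable_cst|].
  apply: filterS q'Q => x /andP[q'1 _] _.
  rewrite patchE /f /=; rewrite indicE; case: (x \in S) => /=; last first.
    rewrite !(mul0r, normr0) powR0 ?mule0//.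
    by rewrite gt_eqF// (lt_le_trans _ q'1).
  rewrite normr1 !mul1r -EFinM ger0_norm ?powR_ge0//; congr EFin.
  rewrite -(@mulr_powRB1 _ (l^-1)%R (q' x))//; last exact: lt_le_trans q'1.
  by rewrite mulrA divff ?gt_eqF// mul1r.
rewrite ge0_integralZl//; last 2 first.
- by move=> x _; exact: poweR_ge0.
- by rewrite lee_fin ltW.
by rewrite -/(modular mu q' (EFin \o \1_S) l) -/J JE.
Qed.

End duality.

Lemma leb_aeS (R : realType) n (X Y : 'cV[R]_n -> Prop) : (forall x, X x -> Y x) ->
  {ae leb R n, forall x, X x} -> {ae leb R n, forall x, Y x}.
Proof. by move=> XY; apply: filterS => //; exact: (ae_filter_ringOfSetsType (leb R n)). Qed.

Section normLq_theory.
Context {R : realType} {n : nat}.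
Local Notation V := 'cV[R]_n.
Local Notation mu := (leb R n).
Variable q : V -> R.
Hypotheses (q1 : (forall x, 1 <= q x)%R) (mq : lmeasurable_fun q).
Implicit Types (f g : V -> R).

Let q0 x : (0 <= q x)%R. Proof. exact: le_trans (q1 x). Qed.

Lemma normLq_ge0 f : 0 <= normLq q f.
Proof. exact: luxemburg_ge0. Qed.

Lemma le_normLq f g : (forall x, `|f x| <= `|g x|)%R -> normLq q f <= normLq q g.
Proof. by move=> fg; apply: le_luxemburg => // x; rewrite lee_fin. Qed.

Let mE f : lmeasurable_fun f ->
  measurable_fun (setT : set (Rn R n)) (EFin \o f : Rn R n -> \bar R).
Proof. by move=> mf; exact: (measurable_EFinP _ _).2. Qed.

Lemma ae_le_normLq f g : lmeasurable_fun f -> lmeasurable_fun g ->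
  {ae mu, forall x, (`|f x| <= `|g x|)%R} -> normLq q f <= normLq q g.
Proof.
move=> mf mg fg; apply: (@ae_le_luxemburg _ (Rn R n) R mu q q1 mq _ _ (mE mf) (mE mg)).
by apply: (leb_aeS _ fg) => x; rewrite lee_fin.
Qed.

Lemma normLq0 : normLq q (fun=> 0%R) = 0.
Proof. exact: (@luxemburg0 _ (Rn R n) R mu q q1). Qed.

Lemma normLqZ_le (c : R) f : (0 <= c)%R -> normLq q (fun x => c * f x)%R <= c%:E * normLq q f.
Proof.
rewrite le_eqVlt => /predU1P[<-|c0].
  rewrite mul0e (_ : (fun _ => _) = fun=> 0%R) ?normLq0//.
  by apply/funext => x; rewrite mul0r.
exact: (@luxemburgZ_le _ (Rn R n) R mu q c (EFin \o f) c0).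
Qed.

Lemma normLq_norm f : normLq q (fun x => `|f x|%R) = normLq q f.
Proof. by apply/le_anti/andP; split; apply: le_normLq => x; rewrite normr_id. Qed.

Lemma lmeasurable_norm f : lmeasurable_fun f -> lmeasurable_fun (fun x => `|f x|%R).
Proof. by move=> mf; exact: (measurableT_comp (@normr_measurable R setT) mf). Qed.

Lemma normLqD f g : lmeasurable_fun f -> lmeasurable_fun g ->
  normLq q (fun x => f x + g x)%R <= normLq q f + normLq q g.
Proof.
move=> mf mg; rewrite -(normLq_norm f) -(normLq_norm g).
apply: (@le_trans _ _ (normLq q (fun x => `|f x| + `|g x|)%R)).
  by apply: le_normLq => x; rewrite [leRHS]ger0_norm ?addr_ge0// ler_normD.
apply: (@luxemburgD _ (Rn R n) R mu q q1 mq _ _ (mE (lmeasurable_norm mf)) (mE (lmeasurable_norm mg))).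
  by move=> x; rewrite lee_fin.
by move=> x; rewrite lee_fin.
Qed.

Lemma normLq_nneseries (h : V -> R) (g : nat -> V -> R) :
  lmeasurable_fun h -> (forall j, lmeasurable_fun (g j)) ->
  {ae mu, forall x, `|h x|%:E <= \sum_(0 <= j <oo) `|g j x|%:E} ->
  normLq q h <= \sum_(0 <= j <oo) normLq q (g j).
Proof.
move=> mh mg hg.
have mG j : measurable_fun (setT : set (Rn R n)) (fun x : Rn R n => `|g j x|%:E).
  exact: (mE (lmeasurable_norm (mg j))).
have G0 j (x : Rn R n) : 0 <= `|g j x|%:E by rewrite lee_fin.
pose G j (x : Rn R n) := `|g j x|%:E.
rewrite (_ : \sum_(0 <= j <oo) normLq q (g j) = \sum_(0 <= j <oo) luxemburg mu (q : Rn R n -> R) (G j)).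
  apply: le_trans (@luxemburg_nneseries _ (Rn R n) R mu q q1 mq G mG G0).
  apply: (@ae_le_luxemburg _ (Rn R n) R mu q q1 mq (EFin \o h) (fun x => \sum_(0 <= j <oo) G j x) (mE mh)).
    by apply: ge0_emeasurable_sum => [j x _ _|j _]; [exact: G0|exact: mG].
  apply: (leb_aeS _ hg) => x hx; rewrite [leRHS]gee0_abs//.
  by apply: nneseries_ge0 => j _ _; exact: G0.
by apply: eq_eseriesr => j _; exact/esym/normLq_norm.
Qed.

Lemma lmeasurable_restr f (E : set V) : lmeasurable_fun f -> lmeasurable E ->
  lmeasurable_fun (restr f E).
Proof.
by move=> mf mE'; apply: measurable_funM => //; exact: (measurable_indic (mE' : measurable (E : set (Rn R n)))).
Qed.

Lemma restr_le f (E F : set V) x : E `<=` F -> (`|restr f E x| <= `|restr f F x|)%R.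
Proof.
move=> EF; rewrite /restr !normrM ler_wpM2l//.
rewrite !ger0_norm// !indicE ler_nat; case: (boolP (x \in E)) => // xE.
by rewrite mem_set//; apply: EF; exact: set_mem.
Qed.

Lemma normLq_restr_le f (E F : set V) : E `<=` F ->
  normLq q (restr f E) <= normLq q (restr f F).
Proof. by move=> EF; apply: le_normLq => x; exact: restr_le. Qed.

Lemma restr_setT f : restr f setT = f.
Proof. by apply/funext => x; rewrite /restr indicT/= mulr1. Qed.

Lemma normLq_restr f (E : set V) : normLq q (restr f E) <= normLq q f.
Proof. by rewrite -[X in _ <= normLq q X]restr_setT; exact: normLq_restr_le. Qed.

End normLq_theory.

(** * Norm estimates for T on a single dyadic shell *)

Section size_estimate.
Context {R : realType} {n : nat}.
Variables (A : 'M[R]_n.+1) (Delta : set 'cV[R]_n.+1) (P : 'M[R]_n.+1) (r : R).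
Hypotheses (uA : A \in unitmx) (uP : P \in unitmx)
  (DeltaE : Delta = [set x | enorm (P *m x) < 1]%R)
  (Delta1 : leb R n.+1 Delta = 1%E) (r1 : (1 < r)%R)
  (rDelta : dilate r Delta `<=` mximage A Delta).
Variables (q : 'cV[R]_n.+1 -> R) (delta2 : R).
Hypotheses (hq : Bclass A Delta q) (delta20 : (0 < delta2)%R)
  (hdelta2 : delta2_condition A Delta q delta2).
Local Notation B := (Bk A Delta).
Local Notation b := (absdet A).
Local Notation mu := (leb R n.+1).
Local Notation V := 'cV[R]_n.+1.
Implicit Types (k l j : int) (x y : V).

Let q1 : (forall x, 1 <= q x)%R. Proof. by case: hq => -[]. Qed.
Let mq : lmeasurable_fun q. Proof. by case: hq => -[]. Qed.
Let b1 : (1 < b)%R. Proof. exact: absdet_gt1 uA DeltaE Delta1 r1 rDelta. Qed.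
Let b0 : (0 < b)%R. Proof. exact: lt_trans b1. Qed.
Let bk0 k : (0 < b ^ k)%R. Proof. exact: exprz_gt0. Qed.
Let muB k : mu (B k) = (b ^ k)%:E. Proof. exact: leb_Bk uA DeltaE Delta1 k. Qed.
Let mB k : lmeasurable (B k). Proof. exact: lmeasurable_Bk uA DeltaE k. Qed.
Let muB0 k : 0 < mu (B k). Proof. by rewrite muB lte_fin. Qed.
Let muBoo k : mu (B k) < +oo. Proof. by rewrite muB ltry. Qed.
Let q_gt1 : exists2 c : R, (1 < c)%R & {ae mu, forall x : Rn R n.+1, (c <= q x)%R}.
Proof.
have [[_ _ qinf _] _] := hq.
exact: (@ess_inf_gt1 _ (Rn R n.+1) R mu q qinf).
Qed.

Lemma conj_norm_indic_Bk : exists cn : int -> R,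
  forall k, (0 < cn k)%R /\ normLq (conj_exponent q) \1_(B k) = (cn k)%:E.
Proof.
exists (fun k => fine (normLq (conj_exponent q) \1_(B k))) => k.
have [c c1 cq] := q_gt1.
have q'0 := @conjugate_ge0 _ (Rn R n.+1) R q q1.
have mq' := @measurable_conjugate _ (Rn R n.+1) R q q1 mq.
have q'Q := @conjugate_bound _ (Rn R n.+1) R mu q c c1 cq.
have N0 : 0 < normLq (conj_exponent q) \1_(B k).
  exact: (@luxemburg_indic_gt0 _ (Rn R n.+1) R mu _ _ (B k) q'0 mq' q'Q (mB k) (muB0 k) (muBoo k)).
have Noo : normLq (conj_exponent q) \1_(B k) < +oo.
  exact: (@luxemburg_indic_lty _ (Rn R n.+1) R mu _ _ (B k) mq' q'Q (mB k) (muB0 k) (muBoo k)).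
have fN : normLq (conj_exponent q) \1_(B k) \is a fin_num by rewrite ge0_fin_numE// ltW.
by split; [rewrite -lte_fin|]; rewrite fineK.
Qed.

Variable conj_norm : int -> R.
Hypothesis conj_norm_gt0 : forall k, (0 < conj_norm k)%R /\
  normLq (conj_exponent q) \1_(B k) = (conj_norm k)%:E.

Lemma conj_norm_ratio : exists2 C : R, (0 < C)%R & forall j k, (j <= k)%R ->
  (conj_norm j <= C * b `^ (delta2 * (j - k)%:~R) * conj_norm k)%R.
Proof.
have [C C0 HC] := hdelta2; exists C => // j k jk.
have H := HC (B k) (B j) (balls_Bk uA uP DeltaE Delta1 r1 rDelta k) (mB j) (Bk_sub uA DeltaE r1 rDelta jk).
have e i : fine (mu (B i)) = (b ^ i)%R by rewrite muB.
rewrite (e j) (e k) in H.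
rewrite (conj_norm_gt0 j).2 (conj_norm_gt0 k).2/= in H.
move: H; rewrite ler_pdivrMr ?(conj_norm_gt0 k).1// invr_expz -expfzDr ?gt_eqF//.
by rewrite -powR_intmul ?(ltW b0)// -powRrM [((j - k)%:~R * _)%R]mulrC.
Qed.

Lemma norm_indic_Bk : exists2 C : R, (0 < C)%R & forall k,
  normLq q \1_(B k) <= (C * b ^ k / conj_norm k)%:E.
Proof.
have [_ [C C0 HC]] := hq; have [c c1 cq] := q_gt1.
exists (2 * C)%R => [|k]; first exact: mulr_gt0.
have [f [I [mf I0 fI intf]]] := @luxemburg_dual _ (Rn R n.+1) R mu q c q1 mq c1 cq (B k) (mB k) (muB0 k) (muBoo k).
have Lf : Lq q f by split => //; apply: le_lt_trans fI _; exact: ltry.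
have [cn0 cnE] := conj_norm_gt0 k.
have e : fine (luxemburg mu (conjugate (q : Rn R n.+1 -> R)) (EFin \o \1_(B k))) = conj_norm k.
  exact: (congr1 fine cnE).
rewrite e in intf.
pose c0 := ((b ^ k)^-1 * (conj_norm k / 2 * I))%R.
have c00 : (0 < c0)%R by rewrite !mulr_gt0 ?invr_gt0.
have H : normLq q (fun x => c0 * \1_(B k) x)%R <= (C * I)%:E.
  apply: (@le_trans _ _ (enormLq q (maximal A Delta f))).
    apply: (@le_luxemburg _ (Rn R n.+1) R mu q) => [x|x]; first exact: le_trans (q1 x).
    have Mx y : B k y -> (c0)%:E <= maximal A Delta f y.
      move=> By; apply: ereal_sup_ubound; exists (B k).
        by split => //; exact: balls_Bk uA uP DeltaE Delta1 r1 rDelta k.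
      by rewrite intf muB -EFinM.
    rewrite /= indicE; case: (boolP (x \in B k)) => [/set_mem Bx|_].
      rewrite mulr1 gtr0_norm//; apply: le_trans (Mx _ Bx) _.
      exact: lee_abs.
    by rewrite mulr0 normr0 abse_ge0.
  apply: le_trans (HC f Lf) _; rewrite EFinM lee_pmul2l//; exact: fI.
have -> : normLq q \1_(B k) = normLq q (fun x => c0^-1 * (c0 * \1_(B k) x))%R.
  by congr normLq; apply/funext => x; rewrite mulrA mulVf ?mul1r// gt_eqF.
apply: (le_trans (normLqZ_le q1 _ _)); first by rewrite invr_ge0 ltW.
apply: (@le_trans _ _ (c0^-1%:E * (C * I)%:E)); first by rewrite lee_pmul2l// lte_fin invr_gt0.
rewrite -EFinM lee_fin /c0 le_eqVlt; apply/orP; left; apply/eqP.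
by field; rewrite !gt_eqF.
Qed.

Variables (D : set (V -> R)) (T : (V -> R) -> (V -> R)).
Hypotheses (hT : sublinear_operator D T) (hDq : Lq q `<=` D)
  (hTsize : size_condition A Delta q T) (hTq : bounded_on (Lq q) (normLq q) T).

Let mC k : lmeasurable (Ck A Delta k). Proof. exact: lmeasurable_Ck uA DeltaE k. Qed.

Lemma integral_Bk_le (g : V -> R) j : lmeasurable_fun g -> (forall x, ~ B j x -> g x = 0%R) ->
  \int[mu]_x `|g x|%:E <= (4 * conj_norm j)%:E * normLq q g.
Proof.
move=> mg gB; have [c c1 cq] := q_gt1; have [cn0 cnE] := conj_norm_gt0 j.
have q'0 := @conjugate_ge0 _ (Rn R n.+1) R q q1.
have l0 : (0 < 2 * conj_norm j)%R by exact: mulr_gt0.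
have [_ m1] : (0 < 2 * conj_norm j)%R /\
    modular mu (conjugate (q : Rn R n.+1 -> R)) (EFin \o \1_(B j)) (2 * conj_norm j) <= 1.
  apply: (@luxemburg_lt _ (Rn R n.+1) R mu _ q'0).
  rewrite [ltLHS](cnE) lte_fin; lra.
have := @holder_indic _ (Rn R n.+1) R mu q c q1 mq c1 cq g (B j) _ mg (mB j) l0 m1.
rewrite (_ : 4 * _ = 2 * (2 * conj_norm j))%R; last by ring.
apply: le_trans; rewrite le_eqVlt; apply/orP; left; apply/eqP.
apply: eq_integral => x _; rewrite indicE; case: (boolP (x \in B j)) => [_|/negP xB].
  by rewrite mulr1.
by rewrite gB ?normr0 ?mul0r// => Bx; apply: xB; exact: mem_set.
Qed.

Lemma size_estimate_far : exists2 C : R, (0 < C)%R & exists w : nat,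
  forall (g : V -> R) j k, Lq q g -> (forall x, ~ B j x -> g x = 0%R) ->
  (j + w%:Z <= k)%R ->
  normLq q (restr (T g) (Ck A Delta k)) <=
    (C * b `^ (delta2 * (j - k)%:~R))%:E * normLq q g.
Proof.
have [C1 C10 HC1] := conj_norm_ratio; have [C2 C20 HC2] := norm_indic_Bk.
have [C3 C30 HC3] := hTsize.
have [w Hw] := rho_sub_ge uA uP DeltaE Delta1 r1 rDelta.
exists (C3 * b ^ w%:Z * 4 * C1 * C2)%R; first by rewrite !mulr_gt0.
exists (w + 2)%N => g j k Lg gB jk.
have jk1 : (j + 1 <= k - 1)%R by move: jk; clear; lia.
have jkw : (j + w%:Z <= k)%R by move: jk; clear; lia.
have jkk : (j <= k)%R by move: jk; clear; lia.
have mg : lmeasurable_fun g by case: Lg.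
have [cg sg] := supp_Bk uA uP DeltaE r1 rDelta gB.
have fN : normLq q g \is a fin_num by rewrite ge0_fin_numE ?normLq_ge0//; case: Lg.
have N0 : (0 <= fine (normLq q g))%R by rewrite fine_ge0// normLq_ge0.
have NE : normLq q g = (fine (normLq q g))%:E by rewrite fineK.
pose c := (C3 * (b ^ (w%:Z - k) * (4 * conj_norm j * fine (normLq q g))))%R.
have [cj0 _] := conj_norm_gt0 j; have [ck0 _] := conj_norm_gt0 k.
have cj4 : (0 <= 4 * conj_norm j)%R := mulr_ge0 (ler0n R 4) (ltW cj0).
have c0 : (0 <= c)%R.
  exact: mulr_ge0 (ltW C30) (mulr_ge0 (ltW (bk0 _)) (mulr_ge0 cj4 N0)).
have Tgc : {ae mu, forall x, (`|restr (T g) (Ck A Delta k) x| <= `|c * \1_(B k) x|)%R}.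
  apply: (leb_aeS _ (HC3 g Lg cg)) => x Hx; rewrite /restr.
  rewrite [\1_(Ck A Delta k) x]indicE; case: (boolP (x \in Ck A Delta k)) => [/set_mem Cx|_];
    last by rewrite mulr0 normr0.
  have Bx : B k x by case: Cx.
  rewrite mulr1 indicE mem_set// mulr1 (ger0_norm c0) -lee_fin.
  have nsx : ~ supp g x.
    move=> /sg Bjx; case: Cx => _; apply; exact: (Bk_sub uA DeltaE r1 rDelta jk1) Bjx.
  apply: le_trans (Hx nsx) _; rewrite /c EFinM; apply: lee_wpmul2l; first by rewrite lee_fin ltW.
  apply: (@le_trans _ _ (\int[mu]_y ((b ^ (w%:Z - k))%:E * `|g y|%:E))).
    apply: (@ge0_le_integral_setT _ (Rn R n.+1) R mu) => y.
      by rewrite lee_fin divr_ge0// /rho; case: ifP => // _; rewrite ltW.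
    rewrite -EFinM lee_fin mulrC.
    have [gy0|gy0] := eqVneq (g y) 0%R; first by rewrite gy0 normr0 !mulr0.
    have Bjy : B j y by apply: contrapT => /gB /eqP; rewrite (negPf gy0).
    rewrite ler_wpM2r// -[(w%:Z - k)%R]opprB -invr_expz lef_pV2 ?posrE//; last first.
      exact: lt_le_trans (bk0 _) (Hw k j x y jkw Cx Bjy).
    exact: (Hw k j x y jkw Cx Bjy).
  rewrite (@ge0_integralZl _ (Rn R n.+1) R mu); [|exact: measurableT| | |]; first last.
  - by rewrite lee_fin ltW.
  - by move=> y _; rewrite lee_fin.
  - by apply/measurable_EFinP; exact: lmeasurable_norm.
  rewrite EFinM; apply: lee_wpmul2l; first by rewrite lee_fin ltW.
  by rewrite EFinM -NE; exact: integral_Bk_le.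
have mTg : lmeasurable_fun (T g) by apply: (op_measurable hT); exact: hDq.
have mR := lmeasurable_restr mTg (mC k).
have mI : lmeasurable_fun (fun x : V => c * \1_(B k) x)%R.
  apply: measurable_funM; first exact: measurable_cst.
  exact: (measurable_indic (mB k : measurable (B k : set (Rn R n.+1)))).
apply: le_trans (ae_le_normLq q1 mq mR mI Tgc) _.
apply: le_trans (normLqZ_le q1 _ c0) _.
apply: le_trans (lee_wpmul2l _ (HC2 k)) _; first by rewrite lee_fin.
rewrite NE -!EFinM lee_fin.
rewrite (_ : c * _ = C3 * 4 * C2 * fine (normLq q g) * (b ^ (w%:Z - k) * b ^ k) *
   (conj_norm j / conj_norm k))%R; last by rewrite /c; ring.
rewrite -expfzDr ?gt_eqF// subrK.
rewrite (_ : C3 * b ^ w%:Z * 4 * C1 * C2 * b `^ (delta2 * (j - k)%:~R) * fine (normLq q g) =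
  C3 * 4 * C2 * fine (normLq q g) * b ^ w%:Z * (C1 * b `^ (delta2 * (j - k)%:~R)))%R; last by ring.
apply: ler_wpM2l; first by rewrite !mulr_ge0// ltW.
by rewrite ler_pdivrMr//; exact: HC1.
Qed.

(* For [j >= k - w] boundedness on [L^q] is enough: the factor lost is at most
   [b ^ (w * delta2)]. *)
Lemma size_estimate : exists2 C : R, (0 < C)%R &
  forall (g : V -> R) j k (E : set V), Lq q g -> (forall x, ~ B j x -> g x = 0%R) ->
  lmeasurable E -> ((j < k)%R -> E `<=` Ck A Delta k) ->
  normLq q (restr (T g) E) <=
    (C * b `^ (- delta2 * (Num.max (k - j) 0)%:~R))%:E * normLq q g.
Proof.
have [C C0 [w Hw]] := size_estimate_far; have [C' C'0 HC'] := hTq.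
exists (C + C' * b `^ (delta2 * w%:R))%R; first by rewrite addr_gt0 ?mulr_gt0 ?powR_gt0.
move=> g j k E Lg gB mE Ek; have N0 := normLq_ge0 q g.
have pw (t : R) : (0 < b `^ t)%R by exact: powR_gt0.
set m : int := Num.max (k - j)%R 0%R.
have [/andP[jk jkw]|far] := boolP ((j < k)%R && (j + w%:Z <= k)%R).
  have kj0 : (0 <= k - j)%R by rewrite subr_ge0 ltW.
  apply: le_trans (normLq_restr_le q1 _ (Ek jk)) _.
  apply: le_trans (Hw g j k Lg gB jkw) _.
  have -> : (delta2 * (j - k)%:~R = - delta2 * m%:~R :> R)%R.
    by rewrite /m max_l// -(opprB k j) mulrNz mulrN mulNr.
  by apply: lee_wpmul2r => //; rewrite lee_fin ler_pM2r// lerDl mulr_ge0// ltW.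
have mw : (m <= w%:Z)%R by move: far; rewrite /m; clear; lia.
apply: le_trans (normLq_restr q1 _ _) _; apply: le_trans (HC' g Lg).2 _.
apply: lee_wpmul2r => //; rewrite lee_fin mulrDl -mulrA -powRD; last by rewrite (gt_eqF b0) implybT.
rewrite (@le_trans _ _ (C' * b `^ (delta2 * w%:R + - delta2 * m%:~R))%R)//; last first.
  by rewrite lerDr mulr_ge0// ltW.
rewrite ler_peMr ?(ltW C'0)// -[leLHS](powRr0 b) ler_powR// ?(ltW b1)//.
by rewrite mulNr subr_ge0 ler_pM2l// -[leRHS]/(w%:Z%:~R) ler_int.
Qed.

End size_estimate.

(** * Summation over the shells *)

Section esum_extra.
Context {R : realType}.

Lemma esumZ_le (T : choiceType) (c : R) (a : T -> \bar R) : (0 <= c)%R -> (forall i, 0 <= a i) ->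
  \esum_(i in setT) (c%:E * a i) <= c%:E * \esum_(i in setT) a i.
Proof.
move=> c0 a0; apply: ge_ereal_sup => _ [F [fF _] <-].
rewrite -ge0_mule_fsumr//; apply: lee_wpmul2l; first by rewrite lee_fin.
by apply: ereal_sup_ubound; exists F.
Qed.

Lemma esumZ_ge (T : choiceType) (c : R) (a : T -> \bar R) : (0 < c)%R -> (forall i, 0 <= a i) ->
  (c%:E * (\esum_(i in setT) a i) <= \esum_(i in setT) (c%:E * a i))%E.
Proof.
move=> c0 a0; rewrite -lee_pdivlMl//.
have ca i : 0 <= c%:E * a i by rewrite mule_ge0// lee_fin ltW.
apply: le_trans (esumZ_le _ ca); last by rewrite invr_ge0 ltW.
apply: le_esum => i _; rewrite muleA -EFinM mulVf ?gt_eqF// mul1e.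
by [].
Qed.

Lemma esum_exchange (T1 T2 : choiceType) (a : T1 -> T2 -> \bar R) :
  (forall i j, 0 <= a i j) ->
  \esum_(i in setT) \esum_(j in setT) a i j = \esum_(j in setT) \esum_(i in setT) a i j.
Proof.
move=> a0; rewrite !esum_esum//.
rewrite (reindex_esum (setT `*`` (fun=> setT)) (setT `*`` (fun=> setT)) (fun x : T2 * T1 => (x.2, x.1)))//.
split => //.
  by move=> [x1 x2] [y1 y2] _ _ /= [-> ->].
by move=> [i j] _; exists (j, i).
Qed.

End esum_extra.

Lemma young_poweR (R : realType) (p s : R) (u : \bar R) : (1 < p)%R -> (0 <= s)%R -> 0 <= u ->
  (p * s `^ (p - 1))%:E * u <= u `^ p + ((p - 1) * s `^ p)%:E.
Proof.
move=> p1 s0; have p0 : (0 < p)%R by exact: lt_trans p1.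
have p10 : (0 < p - 1)%R by rewrite subr_gt0.
case: u => [u| |]//= u0; last first.
  rewrite gt_eqF// addye// leey. by [].
rewrite lee_fin in u0; rewrite -EFinM -EFinD lee_fin.
have q0 : (0 < p / (p - 1))%R by exact: divr_gt0.
have e : (p^-1 + (p / (p - 1))^-1 = 1)%R by rewrite invf_div; field; rewrite gt_eqF.
have := conjugate_powR u0 (powR_ge0 s (p - 1)) p0 q0 e.
rewrite -powRrM (_ : (p - 1) * (p / (p - 1)) = p)%R; last by field; rewrite gt_eqF.
move: (u `^ p)%R (s `^ p)%R (s `^ (p - 1))%R => U S S1.
move=> /(ler_wpM2l (ltW p0)) H.
rewrite (_ : p * S1 * u = p * (u * S1))%R; last by ring.
apply: (le_trans H); rewrite le_eqVlt; apply/orP; left; apply/eqP.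
by field; rewrite !gt_eqF.
Qed.

Section schur.
Context {R : realType} {I : choiceType}.
Variables (K : I -> I -> R) (M p : R).
Hypotheses (K0 : forall i j, (0 <= K i j)%R) (M0 : (0 < M)%R) (p1 : (1 < p)%R).
Hypotheses (KM : forall i, \esum_(j in [set: I]) (K i j)%:E <= M%:E)
  (KM' : forall j, \esum_(i in [set: I]) (K i j)%:E <= M%:E).

Let p0 : (0 < p)%R. Proof. exact: lt_trans p1. Qed.

(* Young's inequality is summed with [s] the [k]-average of [u]. *)
Lemma jensen_esum (k : I -> R) (u : I -> \bar R) : (forall j, (0 <= k j)%R) ->
  \esum_(j in [set: I]) (k j)%:E <= M%:E -> (forall j, 0 <= u j) ->
  M%:E * ((M^-1)%:E * \esum_(j in [set: I]) ((k j)%:E * u j)) `^ p <=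
  \esum_(j in [set: I]) ((k j)%:E * u j `^ p).
Proof.
move=> k0 kM u0; set S := \esum_(j in _) (_ * u j); set W := leRHS.
have ku j : 0 <= (k j)%:E * u j by rewrite mule_ge0// lee_fin.
have kup j : 0 <= (k j)%:E * u j `^ p by rewrite mule_ge0 ?poweR_ge0// lee_fin.
have S0 : 0 <= S by exact: esum_ge0.
have W0 : 0 <= W by exact: esum_ge0.
have p10 : (0 <= p - 1)%R by rewrite subr_ge0 ltW.
have main (s : R) : (0 < s)%R -> (p * s `^ (p - 1))%:E * S <= W + ((p - 1) * s `^ p)%:E * M%:E.
  move=> s0; apply: (@le_trans _ _ (\esum_(j in [set: I])
      ((k j)%:E * u j `^ p + ((p - 1) * s `^ p)%:E * (k j)%:E))).
    apply: le_trans (esumZ_ge (mulr_gt0 p0 (powR_gt0 _ s0)) ku) _.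
    apply: le_esum => j _; rewrite muleCA.
    rewrite [X in _ + X]muleC -muleDr//; last first.
      by rewrite ge0_adde_def// inE ?poweR_ge0// lee_fin mulr_ge0// powR_ge0.
    apply: lee_wpmul2l; first by rewrite lee_fin.
    by apply: young_poweR => //; exact: ltW.
  have c0 : (0 <= (p - 1) * s `^ p)%R by rewrite mulr_ge0// powR_ge0.
  rewrite esumD => [|j _|j _]; [|exact: kup|by rewrite -EFinM lee_fin mulr_ge0].
  apply: leeD2l; apply: le_trans (esumZ_le c0 _) _ => [j|]; first by rewrite lee_fin.
  by apply: lee_wpmul2l; rewrite ?lee_fin.
have [Soo|Soo] := eqVneq S +oo.
  have := main 1%R ltr01; rewrite Soo !powR1 !mulr1 gt0_muley ?lte_fin//.
  rewrite -EFinM leye_eq => /eqP H.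
  have -> : W = +oo by move: H; case: (W) W0 => //= w _.
  by rewrite leey.
have fS : S \is a fin_num by rewrite ge0_fin_numE// lt_neqAle Soo leey.
have [S00|Sn0] := eqVneq S 0.
  by rewrite S00 mule0 poweR0r ?gt_eqF// mule0.
pose s := (M^-1 * fine S)%R.
have s0 : (0 < s)%R.
  by rewrite mulr_gt0 ?invr_gt0// fine_gt0// lt0e Sn0 S0 ltey.
have SE : S = (M * s)%:E by rewrite /s mulrA mulfV ?gt_eqF// mul1r fineK.
have -> : (M^-1)%:E * S = s%:E by rewrite SE -EFinM mulrA mulVf ?gt_eqF// mul1r.
have := main s s0; rewrite SE -!EFinM.
have sp : (s `^ p = s * s `^ (p - 1))%R by rewrite mulr_powRB1// ltW.
case: (W) W0 => [w| |]//= w0; last by move=> _; rewrite leey.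
rewrite -EFinD !lee_fin sp => H.
by lra.
Qed.

Lemma schur_test (u : I -> \bar R) : (forall j, 0 <= u j) ->
  \esum_(i in [set: I]) ((M^-1)%:E * \esum_(j in [set: I]) ((K i j)%:E * u j)) `^ p <=
  \esum_(j in [set: I]) u j `^ p.
Proof.
move=> u0.
have Kup i j : 0 <= (K i j)%:E * u j `^ p by rewrite mule_ge0 ?poweR_ge0// lee_fin.
set L := fun i => (_ * _) `^ p.
have L0 i : 0 <= L i by exact: poweR_ge0.
rewrite -(@lee_pmul2l _ M%:E) ?lte_fin//.
apply: le_trans (esumZ_ge M0 L0) _.
apply: (@le_trans _ _ (\esum_(i in [set: I]) \esum_(j in [set: I]) ((K i j)%:E * u j `^ p))).
  by apply: le_esum => i _; exact: jensen_esum.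
rewrite esum_exchange//.
apply: (@le_trans _ _ (\esum_(j in [set: I]) (M%:E * u j `^ p))); last first.
  by apply: esumZ_le => [|j]; [exact: ltW|exact: poweR_ge0].
apply: le_esum => j _.
have [->|uoo] := eqVneq (u j `^ p) +oo; first by rewrite gt0_muley ?lte_fin// leey.
have fu : u j `^ p \is a fin_num by rewrite ge0_fin_numE ?poweR_ge0// lt_neqAle uoo leey.
have fu0 : (0 <= fine (u j `^ p))%R by rewrite fine_ge0// poweR_ge0.
rewrite -(fineK fu) muleC.
under eq_esum do rewrite muleC.
apply: le_trans (esumZ_le fu0 _) _ => [i|]; first by rewrite lee_fin.
by apply: lee_wpmul2l; rewrite ?lee_fin.
Qed.

End schur.

Lemma esum_geometric (R : realType) (a : R) : (0 <= a < 1)%R ->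
  \esum_(z in [set: int]) (a ^+ `|z|%N)%:E <= (2 / (1 - a))%:E.
Proof.
move=> /andP[a0 a1]; have a10 : (0 < 1 - a)%R by rewrite subr_gt0.
have an m : (0 <= a ^+ m)%R by exact: exprn_ge0.
have half (f : nat -> int) (P : set int) : set_bij setT P f -> (forall m, (m <= `|f m|)%N) ->
    \esum_(z in P) (a ^+ `|z|%N)%:E <= ((1 - a)^-1)%:E.
  move=> bf fm; rewrite (reindex_esum setT P f)//.
  rewrite -nneseries_esumT; last by move=> m; rewrite lee_fin.
  apply: lime_le; first by apply: is_cvg_nneseries => m _ _; rewrite lee_fin.
  apply: nearW => N; apply: (@le_trans _ _ (\sum_(0 <= m < N) a ^+ m)%:E).
    rewrite -sumEFin; apply: lee_sum => m _; rewrite lee_fin.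
    by apply: ler_wiXn2l => //; exact: ltW.
  rewrite lee_fin -[leRHS]mul1r ler_pdivlMr//.
  have -> : ((\sum_(0 <= m < N) a ^+ m) * (1 - a) = 1 - a ^+ N)%R.
    elim: N => [|N IH]; first by rewrite big_geq// mul0r expr0 subrr.
    by rewrite big_nat_recr//= mulrDl IH exprSr; ring.
  by rewrite gerBl.
have f0 (z : int) : (0 : \bar R) <= (a ^+ `|z|%N)%:E by rewrite lee_fin.
rewrite (esumID [set z : int | (0 <= z)%R])//.
rewrite (_ : (2 / (1 - a))%:E = ((1 - a)^-1)%:E + ((1 - a)^-1)%:E); last first.
  by rewrite -EFinD; congr EFin; ring.
apply: leeD; rewrite setTI.
  apply: (half Posz) => //; split => //.
    by move=> x y _ _ [].
  by move=> [m|m]//= _; exists m.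
apply: (half Negz) => [|m]; last by rewrite NegzE abszN/= leqnSn.
split => //; first by move=> x y _ _ [].
by move=> [m|m]//= _; exists m.
Qed.

Lemma esum_inj_le (R : realType) (I J : choiceType) (g : I -> J) (a : J -> \bar R) :
  injective g -> (forall j, 0 <= a j) ->
  \esum_(i in [set: I]) a (g i) <= \esum_(j in [set: J]) a j.
Proof.
move=> ig a0; rewrite -(esum_image setT g); last by move=> x y _ _; exact: ig.
rewrite [leRHS](esumID (g @` setT))// setTI leeDl//.
by apply: esum_ge0.
Qed.

Section geometric_kernel.
Context {R : realType} {I : choiceType}.
Variables (ix : I -> int) (a C theta p : R).
Hypotheses (ix_inj : injective ix) (a01 : (0 <= a < 1)%R) (C0 : (0 < C)%R) (p1 : (1 <= p)%R).

Let a0 : (0 <= a)%R. Proof. by case/andP: a01. Qed.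

Lemma geometric_kernel_bound (u v : I -> \bar R) (eps : R) :
  (forall i, 0 <= u i) -> (forall i, 0 <= v i) -> (0 < eps)%R ->
  (forall i, v i <= C%:E * \esum_(j in [set: I]) ((a ^+ `|ix i - ix j|%N)%:E * u j)) ->
  ((eps `^ theta)%:E * \esum_(i in [set: I]) (v i `^ (p * (1 + eps)))) `^ (p * (1 + eps))^-1 <=
  (C * (2 / (1 - a)))%:E *
    ((eps `^ theta)%:E * \esum_(i in [set: I]) (u i `^ (p * (1 + eps)))) `^ (p * (1 + eps))^-1.
Proof.
move=> u0 v0 eps0 vu.
set P := (p * (1 + eps))%R; set M := (2 / (1 - a))%R.
have P1 : (1 < P)%R.
  by rewrite (@lt_le_trans _ _ (1 + eps)%R) ?ltrDl// ler_peMl// addr_ge0// ltW.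
have P0 : (0 < P)%R by exact: lt_trans P1.
have M0 : (0 < M)%R by rewrite divr_gt0// subr_gt0; case/andP: a01.
have K0 i j : (0 <= a ^+ `|ix i - ix j|%N)%R by exact: exprn_ge0.
have f0 (z : int) : (0 : \bar R) <= (a ^+ `|z|%N)%:E by rewrite lee_fin exprn_ge0.
have KM i : \esum_(j in [set: I]) (a ^+ `|ix i - ix j|%N)%:E <= M%:E.
  apply: le_trans (esum_geometric a01).
  by apply: (@esum_inj_le _ _ _ (fun j => ix i - ix j)%R (fun z => (a ^+ `|z|%N)%:E)) => // x y /addrI/oppr_inj/ix_inj.
have KM' j : \esum_(i in [set: I]) (a ^+ `|ix i - ix j|%N)%:E <= M%:E.
  apply: le_trans (esum_geometric a01).
  by apply: (@esum_inj_le _ _ _ (fun i => ix i - ix j)%R (fun z => (a ^+ `|z|%N)%:E)) => // x y /addIr/ix_inj.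
have := @schur_test R I (fun i j => a ^+ `|ix i - ix j|%N)%R M P K0 M0 P1 KM KM' u u0.
set S := fun i => \esum_(j in [set: I]) ((a ^+ `|ix i - ix j|%N)%:E * u j) => H.
have S0 i : 0 <= S i by apply: esum_ge0 => j _; rewrite mule_ge0// lee_fin.
have CM0 : (0 < C * M)%R by exact: mulr_gt0.
have vP : \esum_(i in [set: I]) (v i `^ P) <= ((C * M) `^ P)%:E * \esum_(i in [set: I]) (u i `^ P).
  apply: (@le_trans _ _ (\esum_(i in [set: I]) (((C * M) `^ P)%:E * ((M^-1)%:E * S i) `^ P))).
    apply: le_esum => i _; rewrite -poweR_EFin -poweRM; last 2 first.
    - by rewrite lee_fin ltW.
    - by rewrite mule_ge0// lee_fin invr_ge0 ltW.
    apply: le_poweR => //; first exact: ltW.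
    by rewrite muleA -EFinM mulfK ?gt_eqF//; exact: vu.
  apply: le_trans (esumZ_le _ _) _; [exact: powR_ge0|by move=> i; exact: poweR_ge0|].
  by apply: lee_wpmul2l => //; rewrite lee_fin powR_ge0.
have e0 : 0 <= (eps `^ theta)%:E :> \bar R by rewrite lee_fin powR_ge0.
have U0 : 0 <= \esum_(i in [set: I]) (u i `^ P) by apply: esum_ge0 => i _; exact: poweR_ge0.
rewrite -[(C * M)%:E](@poweRVr _ P) ?gt_eqF// ?lee_fin ?(ltW CM0)//.
rewrite -poweRM ?mule_ge0//; last exact: poweR_ge0.
apply: le_poweR; first by rewrite invr_ge0 ltW.
  by rewrite mule_ge0// esum_ge0// => i _; exact: poweR_ge0.
rewrite muleCA poweR_EFin; exact: lee_wpmul2l.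
Qed.

End geometric_kernel.

Section norm_of_restriction.
Context {R : realType} {n : nat}.
Variable q : 'cV[R]_n -> R.
Hypotheses (q1 : (forall x, 1 <= q x)%R) (mq : lmeasurable_fun q).

Lemma normLq_restr_cover (I : eqType) (g : 'cV[R]_n -> R) (E : I -> set 'cV[R]_n) (s : seq I) (K : set 'cV[R]_n) :
  lmeasurable_fun g -> (forall i, lmeasurable (E i)) -> lmeasurable K ->
  (forall i, i \in s -> normLq q (restr g (E i)) < +oo) ->
  (forall x, K x -> exists2 i, i \in s & E i x) -> normLq q (restr g K) < +oo.
Proof.
move=> mg mE; elim: s K => [|i s IH] K mK gs Ks.
  rewrite (_ : restr g K = fun=> 0%R) ?normLq0 ?ltry//.
  by apply/funext => x; rewrite /restr indicE memNset ?mulr0// => /Ks[].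
have mKE : lmeasurable (K `&` E i) by exact: (measurableI _ _ mK (mE i)).
have mKD : lmeasurable (K `\` E i) by exact: (measurableD mK (mE i)).
have -> : restr g K = fun x => (restr g (K `&` E i) x + restr g (K `\` E i) x)%R.
  apply/funext => x; rewrite /restr !indicE -mulrDr; congr (_ * _)%R.
  have [Kx|nKx] := pselect (K x); last by rewrite !memNset ?addr0//; case.
  have [Ex|nEx] := pselect (E i x).
    by rewrite (mem_set Kx) (mem_set (conj Kx Ex : (K `&` E i) x)) memNset ?addr0//; case.
  rewrite (mem_set Kx) (mem_set (conj Kx nEx : (K `\` E i) x)) memNset ?add0r//.
  by case.
apply: le_lt_trans (normLqD q1 mq (lmeasurable_restr mg mKE) (lmeasurable_restr mg mKD)) _.
apply: lte_add_pinfty.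
  apply: le_lt_trans (normLq_restr_le q1 g (@subIsetr _ K (E i))) _.
  by apply: gs; rewrite mem_head.
apply: IH => //.
  by move=> j js; apply: gs; rewrite inE js orbT.
by move=> x [Kx nEx]; have [j] := Ks x Kx; rewrite inE => /predU1P[->//|js Ex]; exists j.
Qed.

End norm_of_restriction.

Section grand_lebesgue.
Context {R : realType} {I : choiceType}.
Variables (p theta : R).
Hypothesis p1 : (1 <= p)%R.
Implicit Types u v : I -> \bar R.

Definition grand_norm u : \bar R := ereal_sup [set
  ((eps `^ theta)%:E * \esum_(i in [set: I]) (u i `^ (p * (1 + eps)))) `^ (p * (1 + eps))^-1
  | eps in [set eps : R | (0 < eps)%R]].

Lemma grand_norm_lty u i : (forall i, 0 <= u i) -> grand_norm u < +oo -> u i < +oo.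
Proof.
move=> u0 /(le_lt_trans (ereal_sup_ubound _)).
set P := (p * (1 + 1))%R.
move=> /(_ (((1 `^ theta)%:E * \esum_(i in [set: I]) (u i `^ P)) `^ P^-1)).
have P0 : (0 < P)%R by rewrite mulr_gt0// (lt_le_trans _ p1).
have /[swap]/[apply] : [set
  ((eps `^ theta)%:E * \esum_(i in [set: I]) (u i `^ (p * (1 + eps)))) `^ (p * (1 + eps))^-1
  | eps in [set eps : R | (0 < eps)%R]] (((1 `^ theta)%:E * \esum_(i in [set: I]) (u i `^ P)) `^ P^-1).
  by exists 1%R => //=.
rewrite powR1 mul1e => /lty_poweRy; rewrite invr_eq0 gt_eqF// => /(_ isT) H.
apply: (@lty_poweRy _ _ P); first by rewrite gt_eqF.
apply: le_lt_trans H; rewrite -(@esum_set1 _ _ i (fun i => u i `^ P)); last exact: poweR_ge0.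
rewrite [leRHS](esumID [set i]); last by move=> j _; exact: poweR_ge0.
by rewrite setTI leeDl// esum_ge0// => j _; exact: poweR_ge0.
Qed.

Lemma grand_norm_geometric_kernel (ix : I -> int) (a C : R) u v :
  injective ix -> (0 <= a < 1)%R -> (0 < C)%R ->
  (forall i, 0 <= u i) -> (forall i, 0 <= v i) ->
  (forall i, v i <= C%:E * \esum_(j in [set: I]) ((a ^+ `|ix i - ix j|%N)%:E * u j)) ->
  grand_norm v <= (C * (2 / (1 - a)))%:E * grand_norm u.
Proof.
move=> ix_inj a01 C0 u0 v0 vu; apply: ge_ereal_sup => _ [eps eps0 <-].
apply: le_trans (geometric_kernel_bound theta ix_inj a01 C0 p1 u0 v0 eps0 vu) _.
apply: lee_wpmul2l; last by apply: ereal_sup_ubound; exists eps.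
by rewrite lee_fin mulr_ge0// ?divr_ge0// ?subr_ge0 ltW//; case/andP: a01.
Qed.

End grand_lebesgue.

Local Close Scope ereal_scope.

(** * Log-Hoelder weights *)

Lemma log_growth (R : realType) (c r : R) : 0 < c -> 1 < r ->
  exists2 K : R, 0 < K & forall (m : nat) (t : R), c * r ^+ m <= t ->
    m.+1%:R <= K * ln (expR 1 + t).
Proof.
move=> c0 r1; have r0 : 0 < r by exact: lt_trans r1.
have lr0 : 0 < ln r by rewrite ln_gt0.
have K0 : 0 <= (1 + `|ln c|) / ln r by rewrite divr_ge0 ?addr_ge0// ltW.
exists ((1 + `|ln c|) / ln r + 1) => [|m t cmt]; first by rewrite ltr_wpDl.
have cr0 : 0 < c * r ^+ m by rewrite mulr_gt0// exprn_gt0.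
have t0 : 0 < t by exact: lt_le_trans cmt.
have L1 : 1 <= ln (expR 1 + t).
  by rewrite -[leLHS](@expRK R) ler_ln ?posrE ?expR_gt0 ?addr_gt0 ?expR_gt0// lerDl ltW.
rewrite -natr1 mulrDl mul1r; apply: lerD => //.
rewrite mulrAC ler_pdivlMr// -[m%:R * _]mulrC mulr_natr -lnXn//.
have : ln (c * r ^+ m) <= ln (expR 1 + t).
  rewrite ler_ln ?posrE ?addr_gt0 ?expR_gt0// (le_trans cmt)// lerDr ltW// expR_gt0.
rewrite lnM ?posrE ?exprn_gt0// => H.
apply: (@le_trans _ _ (ln (expR 1 + t) + `|ln c|)).
  by rewrite -lerBlDr (le_trans _ H)// [leRHS]addrC lerD2l lerNl ler_normr lexx orbT.
by rewrite mulrDl mul1r lerD2l ler_peMr.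
Qed.

Section weights.
Context {R : realType} {n : nat}.
Variables (A : 'M[R]_n.+1) (Delta : set 'cV[R]_n.+1) (P : 'M[R]_n.+1) (r : R).
Hypotheses (uA : A \in unitmx) (uP : P \in unitmx)
  (DeltaE : Delta = [set x | enorm (P *m x) < 1]) (r1 : (1 < r)%R)
  (rDelta : dilate r Delta `<=` mximage A Delta).
Variables (alpha : 'cV[R]_n.+1 -> R) (alphainf : R).
Hypotheses (halpha0 : log_holder_origin alpha) (halphainf : log_holder_infty alpha alphainf).
Local Notation V := 'cV[R]_n.+1.
Local Notation b := (absdet A).

Definition alpha_at (k : int) : R := if k < 0 then alpha 0 else alphainf.

Lemma weight_oscillation : exists2 M : R, 0 < M & forall k x, k = 0 \/ Ck A Delta k x ->
  `|k%:~R * (alpha x - alpha_at k)| <= M.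
Proof.
have [c c0 Hc] := Bk_growth uA uP DeltaE r1 rDelta.
have [K K0 HK] := log_growth c0 r1.
have [C C0 HC] := halpha0; have [C' C'0 HC'] := halphainf.
have L0 (t : R) : 0 <= t -> 0 < ln (expR 1 + t).
  by move=> t0; rewrite ln_gt0// (@lt_le_trans _ _ (expR 1))// ?expR_gt1// lerDl.
exists (K * (C + C')); first by rewrite mulr_gt0 ?addr_gt0.
move=> k x [->|Cx].
  by rewrite mul0r normr0 mulr_ge0// ?ltW// addr_gt0.
have x0 : 0 < enorm x.
  rewrite lt_neqAle enorm_ge0 andbT eq_sym.
  by apply: contraNneq (Ck_neq0 uA DeltaE Cx) => /enorm_eq0 ->.
have main (m : nat) (t a D : R) : 0 < D -> 0 <= t -> D <= C + C' ->
    m%:R <= K * ln (expR 1 + t) -> a <= D / ln (expR 1 + t) -> m%:R * a <= K * (C + C').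
  move=> D0 t0 DC mK aD; apply: (@le_trans _ _ (m%:R * (D / ln (expR 1 + t)))).
    by rewrite ler_wpM2l.
  rewrite mulrA ler_pdivrMr ?L0// mulrC -mulrA [X in _ <= X]mulrCA.
  by rewrite ler_pM// ?ltW.
have [k0|k0] := ltP k 0.
  rewrite /alpha_at k0 normrM.
  have [m km] : exists m : nat, k = - m.+1%:Z by exists `|k|.-1%N; move: k0; clear; lia.
  have -> : `|k%:~R| = m.+1%:R :> R by rewrite km mulrNz normrN normr_nat.
  apply: (main _ (enorm x)^-1 _ C) => //; [by rewrite invr_ge0 ltW|by rewrite lerDl ltW| ].
  apply: HK; have [_ Hm] := Hc m.+1 x.
  have := Hm (_ : Bk A Delta (- m.+1%:Z) x); rewrite -km => /(_ (Ck_Bk Cx)) xm.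
  rewrite -[leLHS]invrK lef_pV2 ?posrE ?invr_gt0 ?mulr_gt0 ?exprn_gt0 ?(lt_trans _ r1)//.
  rewrite invfM (le_trans xm)// ler_wpM2l ?invr_ge0 ?(ltW c0)//.
  rewrite lef_pV2 ?posrE ?exprn_gt0 ?(lt_trans _ r1)//.
  by rewrite ler_weXn2l// ltW.
have [k1|k1] := leP 1 k; last first.
  have -> : k = 0 by move: k0 k1; clear; lia.
  by rewrite mul0r normr0 mulr_ge0// ?ltW// addr_gt0.
rewrite /alpha_at ltNge k0/= normrM.
have [m km] : exists m : nat, k = m.+1%:Z by exists `|k|.-1%N; move: k1; clear; lia.
have -> : `|k%:~R| = m.+1%:R :> R by rewrite km normr_nat.
apply: (main _ (enorm x) _ C') => //; [exact: ltW|by rewrite lerDr ltW| ].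
apply: HK; have [+ _] := Hc m x; apply.
by case: Cx => _; rewrite km intS addrAC subrr add0r.
Qed.

Variable q : V -> R.
Hypothesis (q1 : (forall x, 1 <= q x)%R).
Hypothesis b1 : 1 < b.
Let b0 : 0 < b. Proof. exact: lt_trans b1. Qed.

Lemma weighted_equiv : exists2 M : R, 0 < M & forall k (f : V -> R) (E : set V),
  (E `<=` Ck A Delta k) \/ k = 0 ->
  (normLq q (weighted A alpha k f E) <=
     (M * b `^ (k%:~R * alpha_at k))%:E * normLq q (restr f E))%E /\
  (normLq q (restr f E) <=
     (M * b `^ (- (k%:~R * alpha_at k)))%:E * normLq q (weighted A alpha k f E))%E.
Proof.
have [M M0 HM] := weight_oscillation.
exists (b `^ M); first exact: powR_gt0.
move=> k f E Ek.
have EM x : E x -> `|k%:~R * alpha x - k%:~R * alpha_at k| <= M.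
  by rewrite -mulrBr => Ex; apply: HM; case: Ek => [Ek|->]; [right; exact: Ek|left].
have pw t : 0 <= b `^ t by exact: powR_ge0.
have bn0 (s t : R) : b `^ s * b `^ t = b `^ (s + t).
  by rewrite powRD// (gt_eqF b0) implybT.
have r0 x : ~ E x -> restr f E x = 0.
  by move=> nE; rewrite /restr indicE memNset// mulr0.
split.
  apply: (le_trans _ (normLqZ_le q1 _ _)); last by rewrite mulr_ge0.
  apply: le_normLq => // x; rewrite /weighted.
  have [Ex|nE] := pselect (E x); last by rewrite r0// !mulr0.
  rewrite !normrM ler_wpM2r// -normrM !ger0_norm ?mulr_ge0// bn0 ler_powR ?(ltW b1)//.
  by have := EM x Ex; rewrite ler_norml => /andP[_]; rewrite lerBlDr.
apply: (le_trans _ (normLqZ_le q1 _ _)); last by rewrite mulr_ge0.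
apply: le_normLq => // x; rewrite /weighted.
have [Ex|nE] := pselect (E x); last by rewrite r0// !mulr0.
rewrite mulrA !normrM ler_peMl// -!normrM ger0_norm ?mulr_ge0// !bn0.
rewrite -[leLHS](powRr0 b) ler_powR ?(ltW b1)//.
by have := EM x Ex; rewrite ler_norml => /andP[+ _]; lra.
Qed.

End weights.

Lemma exponent_gap (R : realType) (a0 ainf delta2 eta : R) (a : int -> R) (k l : int) :
  (forall i, a i = if i < 0 then a0 else ainf) ->
  eta = Num.min (delta2 - Num.max a0 ainf) (Num.min a0 ainf) ->
  k%:~R * a k - l%:~R * a l - delta2 * (Num.max (k - l) 0)%:~R <= - eta * (absz (k - l))%:R.
Proof.
move=> aE etaE.
pose amax := Num.max a0 ainf; pose amin := Num.min a0 ainf.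
have a01 : a0 <= amax by rewrite le_max lexx.
have a02 : amin <= a0 by rewrite ge_min lexx.
have ai1 : ainf <= amax by rewrite le_max lexx orbT.
have ai2 : amin <= ainf by rewrite ge_min lexx orbT.
have e1 : eta <= delta2 - amax by rewrite etaE ge_min lexx.
have e2 : eta <= amin by rewrite etaE ge_min lexx orbT.
have up (i j : int) : j <= i -> amin * (i - j)%:~R <= i%:~R * a i - j%:~R * a j <= amax * (i - j)%:~R.
  move=> ij; have ij' : j%:~R <= i%:~R :> R by rewrite ler_int.
  rewrite !aE intrB; case: (ltP i 0) => i0.
    rewrite (le_lt_trans ij i0) -mulrBl ![_ * (i%:~R - _)]mulrC.
    by rewrite !ler_wpM2l ?subr_ge0.
  have i0' : 0 <= i%:~R :> R by rewrite ler0z.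
  case: (ltP j 0) => j0; last first.
    by rewrite -mulrBl ![_ * (i%:~R - _)]mulrC !ler_wpM2l ?subr_ge0.
  have j0' : 0 <= - j%:~R :> R by rewrite oppr_ge0 lerz0 ltW.
  have H1 := ler_wpM2l i0' ai1; have H2 := ler_wpM2l i0' ai2.
  have H3 := ler_wpM2l j0' a01; have H4 := ler_wpM2l j0' a02.
  by apply/andP; split; lra.
have [lk|kl] := leP l k.
  rewrite max_l ?subr_ge0//.
  have -> : (absz (k - l))%:R = (k - l)%:~R :> R by rewrite -[in RHS](@gez0_abs (k - l)) ?subr_ge0.
  have kl0 : 0 <= (k - l)%:~R :> R by rewrite ler0z subr_ge0.
  have /andP[_ H] := up k l lk; have H1 := ler_wpM2r kl0 e1; lra.
rewrite max_r; last by rewrite subr_le0 ltW.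
rewrite mulr0 subr0.
have -> : (absz (k - l))%:R = (l - k)%:~R :> R.
  by rewrite distnC -[in RHS](@gez0_abs (l - k)) ?subr_ge0 ?ltW.
have kl0 : 0 <= (l - k)%:~R :> R by rewrite ler0z subr_ge0 ltW.
have /andP[H _] := up l k (ltW kl); have H1 := ler_wpM2r kl0 e2; lra.
Qed.

(** * Herz norms *)

Local Open Scope ereal_scope.

Lemma closed_set1_cV (R : realType) n (x : 'cV[R]_n.+1) : closed [set x].
Proof.
apply: compact_closed; last exact: compact_set1.
exact: (@norm_hausdorff R 'cV[R]_n.+1).
Qed.

Section herz_core.
Context {R : realType} {n : nat}.
Variables (A : 'M[R]_n.+1) (Delta : set 'cV[R]_n.+1) (q alpha : 'cV[R]_n.+1 -> R).
Variables (delta2 alphainf : R) (D : set ('cV[R]_n.+1 -> R)).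
Variable T : ('cV[R]_n.+1 -> R) -> ('cV[R]_n.+1 -> R).
Local Notation V := 'cV[R]_n.+1.
Local Notation b := (absdet A).
Local Notation mu := (leb R n.+1).
Hypotheses (q1 : (forall x, 1 <= q x)%R) (mq : lmeasurable_fun q) (b1 : (1 < b)%R)
  (leb_origin : mu [set (0%R : V)] = 0)
  (hT : sublinear_operator D T) (hDq : Lq q `<=` D)
  (alpha0_bounds : (0 < alpha 0 < delta2)%R) (alphainf_bounds : (0 < alphainf < delta2)%R).
Local Notation alpha_at := (alpha_at alpha alphainf).
Variables (M1 M2 : R).
Hypothesis weighted_bounds : forall k (f : V -> R) (E : set V),
  (E `<=` Ck A Delta k) \/ k = 0%R ->
  (normLq q (weighted A alpha k f E) <=
     (M1 * b `^ (k%:~R * alpha_at k))%:E * normLq q (restr f E))%E /\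
  (normLq q (restr f E) <=
     (M1 * b `^ (- (k%:~R * alpha_at k)))%:E * normLq q (weighted A alpha k f E))%E.
Hypothesis size_bounds : forall (g : V -> R) j k (E : set V), Lq q g ->
  (forall x, ~ Bk A Delta j x -> g x = 0%R) ->
  lmeasurable E -> ((j < k)%R -> E `<=` Ck A Delta k) ->
  normLq q (restr (T g) E) <=
    (M2 * b `^ (- delta2 * (Num.max (k - j) 0)%:~R))%:E * normLq q g.
Hypotheses (M10 : (0 < M1)%R) (M20 : (0 < M2)%R).

(* The shells [E i] may miss the origin; [F i] completes them to the partition of
   R^n that countable subadditivity requires. *)
Variables (I : choiceType) (ix : I -> int) (e : nat -> I) (E F : I -> set V).
Hypotheses (ix_inj : injective ix) (bij_e : set_bij setT setT e)
  (mE : forall i, lmeasurable (E i)) (mF : forall i, lmeasurable (F i))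
  (tF : trivIset setT F) (F_cover : \bigcup_i F i = setT)
  (FE : forall i, F i `<=` E i `|` [set 0%R])
  (FB : forall i, F i `<=` Bk A Delta (ix i))
  (EC : forall i j, (ix j < ix i)%R -> E i `<=` Ck A Delta (ix i))
  (EC0 : forall i, E i `<=` Ck A Delta (ix i) \/ ix i = 0%R).

Let b0 : (0 < b)%R. Proof. exact: lt_trans b1. Qed.
Let eta := Num.min (delta2 - Num.max (alpha 0%R) alphainf)%R (Num.min (alpha 0%R) alphainf).
Let eta0 : (0 < eta)%R.
Proof.
move: alpha0_bounds alphainf_bounds => /andP[? ?] /andP[? ?].
by rewrite !lt_min subr_gt0 gt_max; apply/and3P; split => //; apply/andP.
Qed.
Definition ratio : R := (b `^ (- eta))%R.
Let ratio0 : (0 < ratio)%R. Proof. exact: powR_gt0. Qed.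
Let ratio1 : (ratio < 1)%R.
Proof.
have h1 : ((1 : R) `^ eta = 1)%R by rewrite powR1.
rewrite /ratio powRN invf_lt1 ?powR_gt0// -[ltLHS]h1.
by rewrite gt0_ltr_powR ?nnegrE// ltW.
Qed.
Let W f i := normLq q (weighted A alpha (ix i) f (E i)).
Let W0 f i : 0 <= W f i. Proof. exact: normLq_ge0. Qed.

Lemma ratio_bounds : (0 <= ratio < 1)%R.
Proof. by rewrite (ltW ratio0) ratio1. Qed.

Lemma normLq_restr_lty f i : (W f i < +oo)%E -> normLq q (restr f (E i)) < +oo.
Proof.
move=> Wf; apply: le_lt_trans (weighted_bounds f (EC0 i)).2 _.
by rewrite lte_mul_pinfty// lee_fin mulr_ge0 ?(ltW M10)// powR_ge0.
Qed.

Lemma normLq_restr_origin f i : lmeasurable_fun f ->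
  normLq q (restr f (F i)) <= normLq q (restr f (E i)).
Proof.
move=> mf; apply: ae_le_normLq => //; [exact: lmeasurable_restr..|].
exists [set 0%R]; split => //.
  by apply: borel_lmeasurable; apply: (@closed_measurable_cV R n.+1); exact: closed_set1_cV.
move=> x /= /negP; rewrite -ltNge => H; apply: contrapT => x0; move: H; apply/negP.
rewrite -leNgt; have [Fx|nFx] := pselect (F i x).
  have Ex : E i x by case: (FE Fx).
  by rewrite /restr !indicE !mem_set.
by rewrite {1}/restr indicE memNset// mulr0 normr0.
Qed.

Lemma restr_D f i : D f -> (W f i < +oo)%E -> Lq q (restr f (F i)).
Proof.
move=> Df Wf; have mf := dom_measurable hT Df; split; first exact: lmeasurable_restr.
by apply: le_lt_trans (normLq_restr_origin i mf) _; exact: normLq_restr_lty.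
Qed.

Lemma herz_core f i : D f -> (forall j, W f j < +oo) ->
  W (T f) i <= (M1 * M2 * M1)%:E *
    (\esum_(j in [set: I]) ((ratio ^+ `|ix i - ix j|%N)%:E * W f j)).
Proof.
move=> Df Wf; set k := ix i.
have mf := dom_measurable hT Df.
have Lf j : Lq q (restr f (F j)) by exact: restr_D.
have mTf := op_measurable hT Df.
have mTfm j : lmeasurable_fun (T (restr f (F j))) by apply: (op_measurable hT); exact: hDq.
have ecov : \bigcup_m F (e m) = setT.
  rewrite -F_cover; apply/seteqP; split => x [m _ Fm]; first by exists (e m).
  by have [_ _ /(_ m Logic.I)[m' _ em]] := bij_e; exists m' => //; rewrite em.
have te : trivIset setT (fun m => F (e m)).
  move=> a b' _ _ ab; have [_ ei _] := bij_e.
  by apply: ei; rewrite ?inE//; exact: tF ab.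
have aeT := op_countably_subadditive hT Df (fun m => mF (e m)) te ecov (fun m => hDq (Lf (e m))).
have H1 : normLq q (restr (T f) (E i)) <=
    \sum_(0 <= m <oo) normLq q (restr (T (restr f (F (e m)))) (E i)).
  apply: (normLq_nneseries q1 mq); [exact: lmeasurable_restr|by move=> j; exact: lmeasurable_restr|].
  apply: (leb_aeS _ aeT) => x Hx.
  have [Ex|nEx] := pselect (E i x); last first.
    rewrite {1}/restr indicE memNset// mulr0 normr0.
    by apply: nneseries_ge0 => j _ _; rewrite lee_fin.
  rewrite /restr indicE mem_set// mulr1.
  by under eq_eseriesr do rewrite mulr1.
have H2 : normLq q (restr (T f) (E i)) <=
    \esum_(j in [set: I]) normLq q (restr (T (restr f (F j))) (E i)).
  apply: le_trans H1 _; rewrite nneseries_esumT; last by move=> m; exact: normLq_ge0.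
  by rewrite (reindex_esum setT setT e).
have pw t : (0 < b `^ t)%R by exact: powR_gt0.
have bD (s t : R) : (b `^ s * b `^ t = b `^ (s + t))%R by rewrite powRD// (gt_eqF b0) implybT.
apply: le_trans (weighted_bounds (T f) (EC0 i)).1 _.
apply: le_trans (lee_wpmul2l _ H2) _; first by rewrite lee_fin mulr_ge0 ?ltW.
apply: le_trans (esumZ_ge _ _) _ => [||]; [by rewrite mulr_gt0|by move=> j; exact: normLq_ge0|].
have rW0 j : 0 <= (ratio ^+ `|ix i - ix j|%N)%:E * W f j.
  by rewrite mule_ge0// lee_fin exprn_ge0// ltW.
have c0 : (0 <= M1 * M2 * M1)%R by rewrite ltW// !mulr_gt0.
apply: le_trans (esumZ_le c0 rW0).
apply: le_esum => j _; set l := ix j.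
have gB x : ~ Bk A Delta l x -> restr f (F j) x = 0%R.
  by move=> nB; rewrite /restr indicE memNset ?mulr0// => /FB.
have H3 : normLq q (restr (T (restr f (F j))) (E i)) <= _ :=
  size_bounds (Lf j) gB (mE i) (@EC i j).
have H4 : normLq q (restr f (F j)) <= _ :=
  le_trans (normLq_restr_origin j mf) (weighted_bounds f (EC0 j)).2.
apply: le_trans (lee_wpmul2l _ H3) _; first by rewrite lee_fin mulr_ge0 ?ltW.
rewrite muleA -EFinM.
apply: le_trans (lee_wpmul2l _ H4) _; first by rewrite lee_fin !mulr_ge0 ?ltW.
rewrite !muleA -!EFinM; apply: lee_wpmul2r; [exact: normLq_ge0|rewrite lee_fin].
set x1 := (b `^ (k%:~R * _))%R; set x2 := (b `^ (- delta2 * _))%R; set x3 := (b `^ (- (l%:~R * _)))%R.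
rewrite (_ : M1 * x1 * (M2 * x2) * (M1 * x3) = M1 * M2 * M1 * (x1 * x2 * x3))%R; last by ring.
apply: ler_wpM2l; first by rewrite !mulr_ge0 ?ltW.
rewrite /x1 /x2 /x3 !bD -powR_mulrn ?(ltW ratio0)// /ratio -powRrM.
apply: ler_powR; first exact: ltW.
have := @exponent_gap R (alpha 0%R) alphainf delta2 eta alpha_at k l (fun=> erefl) erefl.
lra.
Qed.

Variables (p theta : R).
Hypothesis p1 : (1 <= p)%R.

Lemma herz_bounded : exists2 C : R, (0 < C)%R &
  forall f, D f -> grand_norm p theta (W f) < +oo ->
  grand_norm p theta (W (T f)) <= C%:E * grand_norm p theta (W f) /\
  forall i, normLq q (restr (T f) (E i)) < +oo.
Proof.
have C0 : (0 < M1 * M2 * M1)%R by rewrite !mulr_gt0.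
have [r0 r1] := andP ratio_bounds.
have C'0 : (0 < M1 * M2 * M1 * (2 / (1 - ratio)))%R.
  by rewrite mulr_gt0// divr_gt0// subr_gt0.
exists (M1 * M2 * M1 * (2 / (1 - ratio)))%R => // f Df Wf.
have Wfi i : W f i < +oo by exact: (grand_norm_lty p1 i (W0 f) Wf).
have Wle : grand_norm p theta (W (T f)) <= _ :=
  grand_norm_geometric_kernel theta p1 ix_inj ratio_bounds C0 (W0 f) (W0 (T f))
    (fun i => herz_core i Df Wfi).
split=> [|i]; [exact: Wle|apply: normLq_restr_lty].
apply: (grand_norm_lty p1 i (W0 (T f)) _).
apply: (le_lt_trans Wle); apply: lte_mul_pinfty; [by rewrite lee_fin ltW|by []|exact: Wf].
Qed.

End herz_core.

Definition int_of_nat (m : nat) : int := if odd m then Negz m./2 else Posz m./2.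

Lemma int_of_nat_bij : set_bij [set: nat] [set: int] int_of_nat.
Proof.
have intK : cancel int_of_nat (fun z => match z with Posz m => m.*2 | Negz m => m.*2.+1 end).
  by move=> x; rewrite /int_of_nat -[RHS]odd_double_half; case: (odd x).
split => //; first by move=> x y _ _; exact: (can_inj intK).
move=> [m|m] _; [exists m.*2|exists m.*2.+1] => //.
  by rewrite /int_of_nat odd_double doubleK.
by rewrite /int_of_nat oddS odd_double/= uphalf_double.
Qed.

Lemma nonhom_herz_norm_grand (R : realType) n (A : 'M[R]_n.+1) Delta alpha q p theta f :
  nonhom_herz_norm A Delta alpha q p theta f =
  grand_norm p theta (fun k : nat => normLq q (weighted A alpha k%:Z f (Ctk A Delta k))).
Proof.
congr ereal_sup; apply: eq_imagel => eps _; congr ((_ * _) `^ _).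
by rewrite nneseries_esumT// => k; exact: poweR_ge0.
Qed.

Local Close Scope ereal_scope.

Theorem theorem3p3 (R : realType) (n : nat)
  (A : 'M[R]_n.+1) (hA : is_dilation A)
  (Delta : set 'cV[R]_n.+1) (hDelta : is_ellipsoid Delta)
  (hDelta1 : leb R n.+1 Delta = 1%E)
  (r : R) (hr : 1 < r)
  (hDeltar : Delta `<=` dilate r Delta)
  (hrA : dilate r Delta `<=` mximage A Delta)
  (p theta : R) (hp : 1 <= p) (htheta : 0 < theta)
  (q : 'cV[R]_n.+1 -> R) (hq : Bclass A Delta q)
  (delta2 : R) (hdelta2 : 0 < delta2 < 1)
  (hdelta2q : delta2_condition A Delta q delta2)
  (alpha : 'cV[R]_n.+1 -> R) (halpha : Linfty alpha)
  (halpha0 : log_holder_origin alpha)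
  (alphainf : R) (halphainf : log_holder_infty alpha alphainf)
  (h0 : 0 < alpha 0 < delta2) (hinf : 0 < alphainf < delta2)
  (D : set ('cV[R]_n.+1 -> R))
  (T : ('cV[R]_n.+1 -> R) -> ('cV[R]_n.+1 -> R))
  (hT : sublinear_operator D T)
  (hDq : Lq q `<=` D)
  (hTsize : size_condition A Delta q T)
  (hTq : bounded_on (Lq q) (normLq q) T) :
  (herz A Delta alpha q p theta `<=` D ->
     bounded_on (herz A Delta alpha q p theta)
                (herz_norm A Delta alpha q p theta) T) /\
  (nonhom_herz A Delta alpha q p theta `<=` D ->
     bounded_on (nonhom_herz A Delta alpha q p theta)
                (nonhom_herz_norm A Delta alpha q p theta) T).
Proof.
have uA := dilation_unitmx hA.
have [P uP DeltaE] := hDelta.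
have b1 := absdet_gt1 uA DeltaE hDelta1 hr hrA.
have q1 : forall x, 1 <= q x by case: hq => -[].
have mq : lmeasurable_fun q by case: hq => -[].
have d20 : 0 < delta2 by case/andP: hdelta2.
have [cn cnP] := conj_norm_indic_Bk uA DeltaE hDelta1 hr hrA hq.
have [M2 M20 HM2] := size_estimate uA uP DeltaE hDelta1 hr hrA hq d20 hdelta2q cnP hT hDq hTsize hTq.
have [M1 M10 HM1] := weighted_equiv uA uP DeltaE hr hrA halpha0 halphainf q1 b1.
have l0 := leb_0 uA DeltaE hDelta1 hr hrA.
have mC := lmeasurable_Ck uA DeltaE.
have mB := lmeasurable_Bk uA DeltaE.
have main := herz_bounded q1 mq b1 l0 hT hDq h0 hinf HM1 HM2 M10 M20.
have cE (K : set 'cV[R]_n.+1) : compact K -> closed K.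
  by apply: compact_closed; exact: (@norm_hausdorff R 'cV[R]_n.+1).
have mK (K : set 'cV[R]_n.+1) : compact K -> lmeasurable K.
  by move=> /cE cK; apply: borel_lmeasurable; exact: closed_measurable_cV.
have below (k : int) (m : nat) x : Ck A Delta k x -> Bk A Delta m x -> k <= m%:Z.
  move=> [_ nB] Bm; rewrite leNgt; apply/negP => mk; apply: nB.
  by apply: (Bk_sub uA DeltaE hr hrA _ Bm); move: mk; clear; lia.
split=> [hD|hD].
  pose F (k : int) := Ck A Delta k `|` (if k == 0 then [set 0] else set0).
  have F0 k x : F k x -> x = 0 -> k = 0.
    move=> [Cx x0|]; first by have := Ck_neq0 uA DeltaE Cx; rewrite x0 eqxx.
    by case: eqP.
  have mF k : lmeasurable (F k).
    apply: measurableU; first exact: mC.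
    case: ifP => _; last exact: measurable0.
    by apply: borel_lmeasurable; apply: closed_measurable_cV; exact: closed_set1_cV.
  have tF : trivIset setT F.
    move=> k l _ _ [x [Fk Fl]]; have [x0|x0] := pselect (x = 0).
      by rewrite (F0 _ _ Fk x0) (F0 _ _ Fl x0).
    have C k' : F k' x -> Ck A Delta k' x by case=> //; case: ifP.
    exact: (Ck_inj uA uP DeltaE hDelta1 hr hrA (C _ Fk) (C _ Fl)).
  have F_cover : \bigcup_k F k = setT.
    apply/seteqP; split => // x _; have [->|x0] := eqVneq x 0.
      by exists 0 => //; right; rewrite eqxx.
    by have [k Ck] := Ck_cover uA uP DeltaE hr hrA x0; exists k => //; left.
  have FE k : F k `<=` Ck A Delta k `|` [set 0].
    by move=> x [Cx|]; [left|case: ifP => // _; right].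
  have FB k : F k `<=` Bk A Delta k.
    by move=> x [[]//|]; case: ifP => // _ ->; exact: Bk_0 uA DeltaE k.
  have [C C0 HC] := main int id int_of_nat (Ck A Delta) F (@inj_id _) int_of_nat_bij
    mC mF tF F_cover FE FB (fun _ _ _ => @subset_refl _ _) (fun=> or_introl (@subset_refl _ _))
    p theta hp.
  exists C; [exact: C0|move=> f [fl fN]].
  have [H1 H2] := HC f (hD f (conj fl fN)) fN.
  split; last exact: H1.
  split; last first.
    by apply: (le_lt_trans H1); apply: lte_mul_pinfty; [rewrite lee_fin ltW| |exact: fN].
  move=> K cK K0; have mTf := op_measurable hT (hD f (conj fl fN)).
  split; first exact: lmeasurable_restr mTf (mK K cK).
  have [m Km] := compact_Bk_bound uA DeltaE hr hrA cK.
  have nK0 : ~ K 0 by move=> /K0; exact.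
  have [m' Km'] := closed_Bk_away uA uP DeltaE hr hrA (cE K cK) nK0.
  apply: (normLq_restr_cover q1 mq (E := Ck A Delta)
    (s := [seq i%:Z - m'%:Z | i <- iota 0 (m + m').+1]) mTf mC (mK K cK)) => [k _|x Kx].
    exact: H2.
  have x0 : x != 0 by apply: contra_not_neq nK0 => <-.
  have [k Cx] := Ck_cover uA uP DeltaE hr hrA x0; exists k => //.
  have km := below _ _ _ Cx (Km _ Kx).
  have km' : - m'%:Z < k.
    rewrite ltNge; apply/negP => km'; apply: (Km' _ Kx).
    by apply: (Bk_sub uA DeltaE hr hrA km'); case: Cx.
  apply/mapP; exists (absz (k + m'%:Z)); last by move: km km'; clear; lia.
  by rewrite mem_iota; move: km km'; clear; lia.
have mCt k : lmeasurable (Ctk A Delta k) by case: k => [|k]; [exact: mB|exact: mC].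
have CtB k : Ctk A Delta k `<=` Bk A Delta k by case: k => [|k] // x [].
have Ct_cover x : exists k, Ctk A Delta k x.
  have [B0|nB0] := pselect (Bk A Delta 0 x); first by exists 0%N.
  have x0 : x != 0 by apply: contra_not_neq nB0 => ->; exact: Bk_0 uA DeltaE 0.
  have [k Cx] := Ck_cover uA uP DeltaE hr hrA x0.
  have k0 : 0 < k.
    rewrite ltNge; apply/negP => k0; apply: nB0.
    by apply: (Bk_sub uA DeltaE hr hrA k0); case: Cx.
  by case: k k0 Cx => [[|k]|k] // _ Cx; exists k.+1.
have tCt : trivIset setT (Ctk A Delta).
  have H k x : Ck A Delta k.+1%:Z x -> ~ Bk A Delta 0 x.
    move=> [_ nB] B0; apply: nB; apply: (Bk_sub uA DeltaE hr hrA _ B0); clear; lia.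
  move=> [|k] [|l] _ _ [x [/= Ckx Clx]] //.
  - by case: (H _ _ Clx).
  - by case: (H _ _ Ckx).
  - by have [->] := Ck_inj uA uP DeltaE hDelta1 hr hrA Ckx Clx.
have CtE k j : j%:Z < k%:Z -> Ctk A Delta k `<=` Ck A Delta k.
  by rewrite ltz_nat; case: k => [|k] // _ x.
have Ct0 k : Ctk A Delta k `<=` Ck A Delta k \/ k%:Z = 0 by case: k => [|k]; [right|left].
have Ct1 k : Ctk A Delta k `<=` Ctk A Delta k `|` [set 0] by left.
have CtT : \bigcup_k Ctk A Delta k = setT.
  by apply/seteqP; split => // x _; have [k Ck] := Ct_cover x; exists k.
have bij_id : set_bij [set: nat] [set: nat] id.
  by split => // [x y _ _ //|x _]; exists x.
have Posz_inj : injective Posz by move=> x y [].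
have [C C0 HC] := main nat Posz id (Ctk A Delta) (Ctk A Delta) Posz_inj bij_id
  mCt mCt tCt CtT Ct1 CtB CtE Ct0 p theta hp.
exists C; [exact: C0|move=> f [fl fN]].
have gN : (grand_norm p theta (fun k : nat => normLq q (weighted A alpha k%:Z f (Ctk A Delta k))) < +oo)%E.
  by rewrite -nonhom_herz_norm_grand.
have [H1 H2] := HC f (hD f (conj fl fN)) gN.
have H3 : (nonhom_herz_norm A Delta alpha q p theta (T f) <=
    C%:E * nonhom_herz_norm A Delta alpha q p theta f)%E.
  by rewrite !nonhom_herz_norm_grand; exact: H1.
split; last exact: H3.
split; last first.
  by apply: (le_lt_trans H3); apply: lte_mul_pinfty; [rewrite lee_fin ltW| |exact: fN].
move=> K cK _; have mTf := op_measurable hT (hD f (conj fl fN)).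
split; first exact: lmeasurable_restr mTf (mK K cK).
have [m Km] := compact_Bk_bound uA DeltaE hr hrA cK.
apply: (normLq_restr_cover q1 mq (E := Ctk A Delta) (s := iota 0 m.+1) mTf mCt (mK K cK)) => [k _|x Kx].
  exact: H2.
have [[|k] Cx] := Ct_cover x; first by exists 0%N.
by exists k.+1 => //; rewrite mem_iota ltnS -lez_nat; exact: below Cx (Km _ Kx).
Qed.
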